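(* Let $k\ge 2$ and let $F:M\to M$, $F(b,x)=(Ab,f_b(x))$, be a boundary preserving skew product on $M=\mathbb{T}^d\times[0,1]$ as in the context, with each $f_b$ of class $C^k$ in $x$, and suppose there are constants $C_k,\beta>0$ with $$\|f_b-f_{b'}\|_{C^k}\le C_k\|b-b'\|^{\beta}\qquad\text{for all } b,b'\in\mathbb{T}^d .$$ Put $\lambda_b=f_b'(0)$ and let $F_0(b,x)=(Ab,\lambda_b x)$. Let $O=(b_0,0)\in\mathbb{T}^d\times\{0\}$ be a hyperbolic fixed point of $F$. Let $\mu$ be the largest modulus of an eigenvalue of $A$ and let $q$ be a number with $\min(\lambda_{b_0},\lambda_{b_0}^{-1})<q<1$. Then there exist a neighborhood $U=V\times[0,\varepsilon)$ of $O$ in $M$ (with $V$ a neighborhood of $b_0$ in $\mathbb{T}^d$ and $\varepsilon>0$) and a fiber preserving homeomorphism $H$ of $U$ onto its image in $M$, $H(O)=O$, of the form $$H(b,x)=(b,\,x+h_b(x)),\qquad h_b(0)=\frac{\partial h_b}{\partial x}(0)=0,$$ such that: 1. $H$ conjugates $F$ with its fiberwise linearization $F_0$ near $O$: $F\circ H=H\circ F_0$ at every point $(b,x)\in U$ with $F_0(b,x)\in U$. 2. For each fixed $b$, $H$ is of class $C^{k-2}$ in $x$. 3. $H$ is fiberwise Hölder: there exist constants $\tilde C_l>0$ ($0\le l\le k-2$) and $\alpha>0$, with $0<\alpha<\min(\beta,-\log_\mu q)$, such that for every $l$ with $0\le l\le k-2$ and all $b,b'\in V$, $$\|h_b-h_{b'}\|_{C^l}\le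 \tilde C_l\|b-b'\|^{\alpha}.$$
   Context: $\mathbb{T}^d=\mathbb{R}^d/\mathbb{Z}^d$, and $\|b-b'\|$ denotes the distance on $\mathbb{T}^d$. A boundary preserving skew product is a map $F:M\to M$, $M=\mathbb{T}^d\times[0,1]$, $F(b,x)=(Ab,f_b(x))$, where $A$ is a linear hyperbolic automorphism of $\mathbb{T}^d$ (induced by a matrix in $GL(d,\mathbb{Z})$ with no eigenvalue of modulus 1) and each $f_b:[0,1]\to[0,1]$ is an orientation preserving diffeomorphism with $f_b(0)=0$, $f_b(1)=1$. $C^k$-norms are norms of functions of the fiber variable $x$ (sums or maxima of sup-norms of derivatives of order $\le k$), taken over $[0,1]$ for $f_b$ and over $[0,\varepsilon)$ for $h_b$. That $O=(b_0,0)$ is a hyperbolic fixed point of $F$ means $Ab_0=b_0$ and $\lambda_{b_0}=f_{b_0}'(0)\neq1$. *)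

(* Defs.v *)
From HB Require Import structures.
From mathcomp Require Import all_boot all_order all_algebra.
From mathcomp Require Import all_classical all_reals all_analysis.
From mathcomp Require Import complex.
Set Implicit Arguments.
Unset Strict Implicit.
Unset Printing Implicit Defensive.
Import Order.TTheory GRing.Theory Num.Theory.
Import numFieldNormedType.Exports.
Local Open Scope classical_set_scope.
Local Open Scope ring_scope.

Section Torus.
Variables (R : realType) (d : nat).

Definition torus_rel : rel 'cV[R]_d := fun v w => v - w \is a mxOver Num.int.

Lemma torus_rel_refl : reflexive torus_rel.
Proof. by move=> v; apply/mxOverP => i j; rewrite !mxE subrr rpred0. Qed.

Lemma torus_rel_sym : symmetric torus_rel.
Proof.
move=> v w; apply/mxOverP/mxOverP => vw i j;
  by have := vw i j; rewrite !mxE -rpredN opprB.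
Qed.

Lemma torus_rel_trans : transitive torus_rel.
Proof.
move=> w v u /mxOverP vw /mxOverP wu; apply/mxOverP => i j.
by have := rpredD (vw i j) (wu i j); rewrite !mxE addrA subrK.
Qed.

Canonical torus_equiv :=
  EquivRel torus_rel torus_rel_refl torus_rel_sym torus_rel_trans.

Definition torus : Type := quotient_topology {eq_quot torus_equiv}%qT.

Definition euclid_norm (v : 'cV[R]_d) : R := Num.sqrt (\sum_i v i ord0 ^+ 2).

Definition torus_dist (b b' : torus) : R :=
  inf [set r | exists v w : 'cV[R]_d,
    [/\ \pi_torus%qT v = b, \pi_torus%qT w = b' & r = euclid_norm (v - w)]].

(* The map of T^d induced by A; it does not depend on the representative,
   see [torus_mapE]. *)
Definition torus_map (A : 'M[int]_d) (b : torus) : torus :=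
  \pi_torus%qT (map_mx intr A *m repr b).

Lemma torus_mapE (A : 'M[int]_d) (v : 'cV[R]_d) :
  torus_map A (\pi_torus%qT v) = \pi_torus%qT (map_mx intr A *m v).
Proof.
apply/(@eqmodP _ torus_equiv) => /=.
rewrite /torus_rel -mulmxBr.
have : torus_rel (repr (\pi_torus%qT v)) v.
  by apply/(@eqmodP _ torus_equiv); exact: reprK.
rewrite /torus_rel => vZ; apply/mxOverP => i j; rewrite mxE rpred_sum// => l _.
by apply: rpredM; [rewrite mxE; exact: intr_int | exact: (mxOverP vZ)].
Qed.

Definition is_eigenvalue (A : 'M[int]_d) (z : R[i]) : Prop :=
  eigenvalue (map_mx intr A : 'M[R[i]]_d) z.

Definition hyperbolic_automorphism (A : 'M[int]_d) : Prop :=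
  A \in unitmx /\ forall z : R[i], is_eigenvalue A z -> `|z| != 1.

Definition largest_eigenvalue_modulus (A : 'M[int]_d) (mu : R) : Prop :=
  (exists z : R[i], is_eigenvalue A z /\ `|z| = mu%:C%C) /\
  (forall z : R[i], is_eigenvalue A z -> `|z| <= mu%:C%C).

End Torus.

Section FiberRegularity.
Variable R : realType.
Implicit Types (D : set R) (g : R -> R) (x : R).

(* Derivatives relative to D: one-sided at an endpoint of D that lies in D.
   On D they depend only on the restriction of g to D. *)
Definition diff_quotient g x (y : R) : R := (g y - g x) / (y - x).

Definition derivable_in D g x : Prop :=
  cvg (diff_quotient g x y @[y --> within D x^']).

Definition derive_in D g x : R :=
  lim (diff_quotient g x y @[y --> within D x^']).

Definition derive_in_n D (n : nat) g : R -> R := iter n (derive_in D) g.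

Definition class_C (k : nat) D g : Prop :=
  (forall i x, (i < k)%N -> D x -> derivable_in D (derive_in_n D i g) x) /\
  (forall i, (i <= k)%N -> {within D, continuous (derive_in_n D i g)}).

(* Extended-real valued, so that it is +oo when some derivative is unbounded. *)
Definition norm_C (k : nat) D g : \bar R :=
  \big[maxe/0%E]_(i < k.+1)
    ereal_sup [set (`|derive_in_n D i g x|)%:E | x in D].

Definition orientation_preserving_diffeo D g : Prop :=
  [/\ set_bij D D g,
      class_C 1 D g,
      (exists g', [/\ class_C 1 D g', {in D, cancel g g'} & {in D, cancel g' g}])
    & {in D &, {homo g : x y / x < y}}].

End FiberRegularity.

Definition homeomorphism_onto_image (T T' : topologicalType)
    (U : set T) (H : T -> T') : Prop :=
  {within U, continuous H} /\
  exists G : T' -> T, {within H @` U, continuous G} /\ {in U, cancel H G}.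

Section SkewProduct.
Variables (R : realType) (d : nat).
Implicit Types (A : 'M[int]_d) (f h : torus R d -> R -> R).

(* M = T^d x [0, 1] is a subset of T^d x R; a fiber map f_b : [0, 1] -> [0, 1]
   is the restriction to [0, 1] of f b : R -> R. *)
Definition M_set : set (torus R d * R) := [set p | p.2 \in `[0, 1]].

Definition skew_product A f (p : torus R d * R) : torus R d * R :=
  (torus_map A p.1, f p.1 p.2).

Definition boundary_preserving_skew_product A f : Prop :=
  hyperbolic_automorphism R A /\
  forall b, [/\ orientation_preserving_diffeo `[0, 1] (f b),
                f b 0 = 0 & f b 1 = 1].

Definition multiplier f (b : torus R d) : R := derive_in `[0, 1] (f b) 0.

Definition linearization A f : torus R d * R -> torus R d * R :=
  skew_product A (fun b x => multiplier f b * x).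

Definition hyperbolic_fixed_point A f (b0 : torus R d) : Prop :=
  torus_map A b0 = b0 /\ multiplier f b0 != 1.

Definition fiber_map h (p : torus R d * R) : torus R d * R :=
  (p.1, p.2 + h p.1 p.2).

End SkewProduct.

(* Main.v *)
(* First cut off: replacing f_b by f_b0 + chi(b) (f_b - f_b0), with chi = 1 near b0,
   makes every multiplier close to lam = f_b0'(0); replacing F by its inverse if
   lam > 1, F contracts all fibers.  The linearizing coordinate Phi, with
   Phi o F = lam_b Phi, has derivative exp S, where S = psi + S o F for
   psi = ln (f_b' / lam_b), and H is the fiberwise inverse of Phi.  The fiber
   derivatives of S solve affine equations Z = u + a (Z o F) with |a| <= q < 1.
   In the pseudo-metric rho = (modulus of b, b') + |x - x'| the map F is
   Lipschitz, with constant Lam say, so solutions are Hoelder for every exponent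
   g with q Lam^g < 1.  As alpha may be taken as small as one likes, exponents are
   never tracked: a function is just required to be Hoelder for some exponent. *)
Require Import Defs.
From HB Require Import structures.
From mathcomp Require Import all_boot all_order all_algebra.
From mathcomp Require Import all_classical all_reals all_analysis.
From mathcomp Require Import complex ring lra.
Set Implicit Arguments.
Unset Strict Implicit.
Unset Printing Implicit Defensive.
Import Order.TTheory GRing.Theory Num.Theory.
Import numFieldNormedType.Exports.
Local Open Scope classical_set_scope.
Local Open Scope ring_scope.

(** Cutting off is forced by the base: orbits of A leave every neighborhood of b0, so a series along
    orbits needs control of every fiber, while the hypotheses control the multiplier at b0 only. H
    is therefore built over the whole torus and then restricted. The conjugacy applies F once, at a
    point over V, where the cut-off map and F agree. Working with S instead of Phi has two benefits.
    Dividing by lam_b makes psi vanish on the zero section, so the series of psi along orbits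
    converges although its coefficient is 1; and S = 0 there gives H fiber derivative 1 at x = 0.
    Moreover Phi' = exp S is positive, so Phi is invertible on fibers. Termwise differentiation is
    avoided: the formally differentiated equation is solved first, and its solution is then
    recognized as the derivative because the Taylor remainder satisfies an inequality that can be
    iterated. Orders: in x, the derivatives of f_b of order below k are Lipschitz near b0, while the
    k-th is merely continuous. Hence f_b' has k - 2 Hoelder derivatives, and so do psi, S, exp S and
    the fiber derivative of H. *)

Section RealLemmas.
Variable R : realType.
Implicit Types (a b c e g q s t x y z : R).

(** Estimates are proved below by induction on n with an error that decays geometrically; this
    removes the error. *)
Lemma le_geometric_limit q a e C :
  0 <= q < 1 -> (forall n, e <= a + C * q ^+ n) -> e <= a.
Proof.
move=> /andP[q0 q1] h.
have q' : (fun n => a + C * q ^+ n) @ \oo --> a.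
  rewrite -[X in _ --> X]addr0 -[X in _ + X](mulr0 C).
  apply: cvgD; first exact: cvg_cst.
  apply: cvgM; first exact: cvg_cst.
  by apply: cvg_expr; rewrite ger0_norm.
rewrite -(cvg_lim _ q')//; apply: limr_ge; first by apply/cvg_ex; exists a.
exact: nearW.
Qed.

(** * Real powers, and first and second order bounds for exp and ln *)

Lemma powR_lower t g g' : 0 <= t <= 1 -> 0 < g' <= g -> t `^ g <= t `^ g'.
Proof.
move=> /andP[t0 t1] /andP[g0 gg].
have [->|tn0] := eqVneq t 0; first by rewrite !powR0 ?gt_eqF// (lt_le_trans g0).
by apply: ger_powR => //; rewrite lt_neqAle eq_sym tn0 t0.
Qed.

Lemma powR_mono s t g : 0 <= s <= t -> 0 <= g -> s `^ g <= t `^ g.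
Proof.
move=> /andP[s0 st] g0; apply: ge0_ler_powR => //; rewrite nnegrE//.
exact: le_trans st.
Qed.

Lemma powR1E g : 1 `^ g = 1 :> R.
Proof. by rewrite powR1. Qed.

Lemma powR_ge1 t g : 1 <= t -> 0 <= g -> 1 <= t `^ g.
Proof. by move=> t1 g0; rewrite -(powR1E g); apply: powR_mono; rewrite ?ler01. Qed.

Lemma powR_le1 t g : 0 <= t <= 1 -> 0 <= g -> t `^ g <= 1.
Proof. by move=> t1 g0; rewrite -[leRHS](powR1E g); apply: powR_mono. Qed.

Lemma powR_self t g : 0 <= t <= 1 -> 0 < g <= 1 -> t <= t `^ g.
Proof.
by move=> t01 g01; rewrite -{1}(powRr1 (andP t01).1); apply: powR_lower.
Qed.

Lemma powR_lt1 t g : 0 <= t < 1 -> 0 < g -> t `^ g < 1.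
Proof.
move=> /andP[t0 t1] g0; rewrite -[ltRHS](powR1E g).
by apply: gt0_ltr_powR; rewrite ?nnegrE.
Qed.

(** Since L^g tends to 1 as g decreases to 0, a contraction rate q beats any Lipschitz constant L
    once the Hoelder exponent is small. This is where small exponents are gained. *)
Lemma powR_near1 L q : 1 <= L -> q < 1 -> \forall g \near 0^'+, q * L `^ g < 1.
Proof.
move=> L1 q1.
have L0 : 0 < L by lra.
have h1 : (expR \o (fun g => g * ln L)) g @[g --> 0^'+] --> (1 : R).
  have h0 : (g * ln L) @[g --> 0^'+] --> (0 * ln L : R).
    by apply: cvgM; [exact: (@cvg_at_right_filter R R id 0)|exact: cvg_cst].
  have := @continuous_expR R (0 * ln L).
  rewrite /continuous_at [X in nbhs (expR X)]mul0r expR0 => he.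
  by apply: cvg_comp h0 _.
have E : expR \o (fun g => g * ln L) = powR L.
  by apply/funext => g; rewrite /powR gt_eqF.
rewrite E in h1.
have h : (fun g => q * L `^ g) @ 0^'+ --> q.
  by rewrite -[X in _ --> X]mulr1; apply: cvgM; [exact: cvg_cst|].
have FF : Filter (0^'+ : set_system R) by exact: _.
exact: (@cvgr_lt _ _ _ FF _ q h _ q1).
Qed.

Lemma expR_bound1 t : `|t| <= 1 -> `|expR t - 1 - t| <= 2 * t ^+ 2.
Proof.
move=> /ler_normlP[tm tp].
have h1 := expR_ge1Dx t.
have h2 : expR t <= 1 + t + 2 * t ^+ 2.
  have h3 := expR_ge1Dx (- (t / 2)).
  have h4 : 0 < 1 - t / 2 by lra.
  have h5 : expR (t / 2) <= (1 - t / 2)^-1.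
    by rewrite -[leLHS]invrK -expRN lef_pV2 ?posrE ?expR_gt0//; lra.
  have -> : expR t = expR (t / 2) ^+ 2 by rewrite expr2 -expRD; congr expR; field.
  have h6 : expR (t / 2) ^+ 2 <= ((1 - t / 2)^-1) ^+ 2.
    by apply: lerXn2r; rewrite ?nnegrE ?expR_ge0// invr_ge0 ltW.
  apply: (le_trans h6); rewrite exprVn.
  rewrite -[leLHS]mul1r ler_pdivrMr ?exprn_gt0//.
  (* The claim (1 - t/2)^-2 <= 1 + t + 2 t^2 becomes polynomial; the excess is t^2 (1 - t) (5/4 -
     t/2), which is nonnegative for t <= 1. *)
  have -> : (1 + t + 2 * t ^+ 2) * (1 - t / 2) ^+ 2
    = 1 + t ^+2 * (5/4 - 7/4 * t + t^+2 / 2) by field.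
  have : 0 <= t ^+ 2 by exact: sqr_ge0.
  have : 0 <= 5/4 - 7/4 * t + t^+2 / 2.
    have -> : 5/4 - 7/4 * t + t^+2 / 2 = (1 - t) * (5/4 - t/2) by field.
    by apply: mulr_ge0; lra.
  by move=> ? ?; rewrite lerDl mulr_ge0.
rewrite ler_norml; apply/andP; split; have := sqr_ge0 t; lra.
Qed.

Lemma norm_sub_le1 c s t : c <= 1 -> 0 <= s <= c -> 0 <= t <= c -> `|t - s| <= 1.
Proof. by move=> c1 sc tc; rewrite ler_norml; apply/andP; split; lra. Qed.

Lemma powR_half_exponent t g e : 0 <= t <= 1 -> 0 < g -> e <= g / 2 ->
  t `^ g <= t `^ (g / 2) /\ t `^ (g - e) <= t `^ (g / 2).
Proof. by move=> t01 g0 eg; split; apply: powR_lower => //; apply/andP; split; lra. Qed.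

Lemma powR_sum_le C g x y : 0 <= C -> 0 < g -> 0 <= x -> 0 <= y ->
  C * x `^ g + C * y `^ g <= 2 * C * (x + y) `^ g.
Proof.
move=> C0 g0 x0 y0.
have h1 : x `^ g <= (x + y) `^ g by apply: powR_mono; lra.
have h2 : y `^ g <= (x + y) `^ g by apply: powR_mono; lra.
by have := ler_wpM2l C0 h1; have := ler_wpM2l C0 h2; lra.
Qed.

(** The smaller of r^g and m^g is at most r^e m^(g-e), whichever of r and m is the smaller. The
    factor 2 is the one produced by [powR_sum_le]. *)
Lemma powR_interpolation K g e x r m : 0 <= K -> 0 < g -> e <= g / 2 -> 0 < e ->
  0 <= r -> 0 <= m -> x <= K * r `^ g -> x <= 2 * K * m `^ g ->
  x <= 2 * K * (r `^ e * m `^ (g - e)).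
Proof.
move=> K0 g0 eg e0 r0 m0 xr xm.
have split_pow t : t `^ g = t `^ e * t `^ (g - e).
  by rewrite -powRD; [congr (_ `^ _); ring|apply/implyP; rewrite gt_eqF//; lra].
have [rm|/ltW mr] := leP r m.
  apply: (le_trans xr); rewrite split_pow.
  have h : r `^ (g - e) <= m `^ (g - e) by apply: powR_mono; rewrite ?r0//; lra.
  have := ler_wpM2l (mulr_ge0 K0 (powR_ge0 r e)) h.
  have : 0 <= K * (r `^ e * m `^ (g - e)) by rewrite !mulr_ge0 ?powR_ge0.
  lra.
apply: (le_trans xm); rewrite split_pow.
rewrite ler_wpM2l ?mulr_ge0// ler_wpM2r ?powR_ge0//.
by apply: powR_mono; [rewrite m0|exact: ltW].
Qed.

Lemma cross_sum_le x y s t : 0 <= x * t -> 0 <= y * s ->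
  x * s + y * t <= (x + y) * (s + t).
Proof. by move=> ? ?; rewrite mulrDl !mulrDr; lra. Qed.

Lemma near_multiplier s t x e : `|s - t| <= e / 2 -> `|t - x| <= e / 2 ->
  x - e <= s <= x + e.
Proof.
by rewrite !ler_norml => /andP[? ?] /andP[? ?]; apply/andP; split; lra.
Qed.

Lemma multiplier_gap x e : e <= `|1 - x| / 2 ->
  (x < 1 -> x + e < 1) /\ (1 < x -> 1 < x - e).
Proof.
by move=> h; split=> x1; [rewrite ger0_norm in h|rewrite ler0_norm in h]; lra.
Qed.

Lemma ler_normM s t x y : `|s| <= x -> `|t| <= y -> `|s * t| <= x * y.
Proof. by move=> sx ty; rewrite normrM; apply: ler_pM. Qed.

Lemma expR_lip K s t : s <= K -> t <= K -> `|expR t - expR s| <= expR K * `|t - s|.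
Proof.
wlog st : s t / s <= t => [hw|_ tK].
  have [st|/ltW ts] := leP s t; first exact: hw.
  by move=> sK tK; rewrite distrC (distrC t); apply: hw.
rewrite !ger0_norm ?subr_ge0 ?ler_expR//.
have h : expR t - expR s <= expR t * (t - s).
  have -> : expR s = expR t * expR (s - t) by rewrite -expRD; congr expR; ring.
  rewrite -{1}[expR t]mulr1 -mulrBr ler_pM2l ?expR_gt0//.
  by have := expR_ge1Dx (s - t); lra.
by apply: le_trans h _; rewrite ler_wpM2r ?subr_ge0// ler_expR.
Qed.

Lemma ln_lip k s t : 0 < k -> k <= s -> k <= t -> `|ln t - ln s| <= k^-1 * `|t - s|.
Proof.
move=> k0; wlog st : s t / s <= t => [hw|ks _].
  have [st|/ltW ts] := leP s t; first exact: hw.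
  by move=> sK tK; rewrite distrC (distrC t); apply: hw.
have s0 : 0 < s by exact: lt_le_trans ks.
have t0 : 0 < t by exact: lt_le_trans st.
rewrite !ger0_norm ?subr_ge0 ?ler_ln ?posrE//.
rewrite -ln_div ?posrE//.
have h : ln (t / s) <= s^-1 * (t - s).
  have -> : t / s = 1 + s^-1 * (t - s) by field; rewrite gt_eqF.
  apply: le_ln1Dx; rewrite (@lt_le_trans _ _ 0) ?ltrN10// mulr_ge0 ?subr_ge0//.
  by rewrite invr_ge0 ltW.
by apply: le_trans h _; rewrite ler_wpM2r ?subr_ge0// lef_pV2 ?posrE.
Qed.

Lemma expR_quad K s t : s <= K -> t <= K ->
  `|expR t - expR s - expR s * (t - s)| <= 4 * expR K * (t - s) ^+ 2.
Proof.
move=> sK tK; have eK := expR_gt0 K.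
have es : expR s <= expR K by rewrite ler_expR.
have [h|h] := leP `|t - s| 1.
  have -> : expR t - expR s - expR s * (t - s)
      = expR s * (expR (t - s) - 1 - (t - s)).
    by rewrite !mulrBr -expRD mulr1; congr (expR _ - _ - _); ring.
  rewrite normrM ger0_norm ?expR_ge0//.
  apply: (@le_trans _ _ (expR K * (2 * (t - s) ^+ 2))).
    by apply: ler_pM; rewrite ?expR_ge0 ?expR_bound1.
  by have := sqr_ge0 (t - s); nra.
(* For |t - s| > 1 both terms are linear in |t - s|, hence dominated by its square. *)
apply: le_trans (ler_normB _ _) _.
have h1 := expR_lip sK tK.
have h2 : `|expR s * (t - s)| <= expR K * `|t - s|.
  by rewrite normrM ger0_norm ?expR_ge0// ler_wpM2r.
rewrite -[(t - s) ^+ 2]real_normK ?num_real//.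
have : 0 <= expR K * (`|t - s| * (`|t - s| - 1)).
  by rewrite !mulr_ge0// ?expR_ge0//; lra.
have : 0 <= expR K * `|t - s| ^+ 2 by rewrite mulr_ge0 ?expR_ge0 ?exprn_ge0.
lra.
Qed.

(** By concavity, the tangents at s and at t enclose ln t - ln s between (t - s)/t and (t - s)/s,
    and these differ by (t - s)^2/(s t). *)
Lemma ln_quad k s t : 0 < k -> k <= s -> k <= t ->
  `|ln t - ln s - s^-1 * (t - s)| <= (k^-1) ^+ 2 * (t - s) ^+ 2.
Proof.
move=> k0 ks kt.
have s0 : 0 < s by exact: lt_le_trans ks.
have t0 : 0 < t by exact: lt_le_trans kt.
have up x y : 0 < x -> 0 < y -> ln y - ln x <= x^-1 * (y - x).
  move=> x0 y0; rewrite -ln_div ?posrE//.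
  have -> : y / x = 1 + x^-1 * (y - x) by field; rewrite gt_eqF.
  apply: le_ln1Dx; rewrite mulrBr mulVf ?gt_eqF//.
  by have := divr_gt0 y0 x0; rewrite mulrC; lra.
have h1 := up _ _ s0 t0; have h2 := up _ _ t0 s0.
have h3 : s^-1 * (t - s) + t^-1 * (s - t) = (s^-1 * t^-1) * (t - s) ^+ 2.
  by field; rewrite !gt_eqF.
have h4 : (s^-1 * t^-1) * (t - s) ^+ 2 <= (k^-1) ^+ 2 * (t - s) ^+ 2.
  apply: ler_wpM2r; first exact: sqr_ge0.
  by rewrite expr2; apply: ler_pM; rewrite ?invr_ge0 ?lef_pV2 ?posrE// ltW.
by rewrite ler_norml; apply/andP; split; lra.
Qed.
End RealLemmas.

(** * Hoelder functions on an interval and their antiderivatives *)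

Section Antiderivative.
Variable R : realType.
Implicit Types (c e g x y s t K : R).

Lemma powR_small K g e : 0 < g -> 0 <= K -> 0 < e ->
  exists2 r, 0 < r & forall s, 0 <= s <= r -> K * s `^ g < e.
Proof.
move=> g0 K0 e0; have K1 : 0 < K + 1 by lra.
have eK : 0 < e / (K + 1) by rewrite divr_gt0.
exists ((e / (K + 1)) `^ g^-1); first by rewrite powR_gt0.
move=> s /andP[s0 sr]; have h : s `^ g <= e / (K + 1).
  have -> : e / (K + 1) = ((e / (K + 1)) `^ g^-1) `^ g.
    by rewrite -powRrM mulVf ?gt_eqF// powRr1// ltW.
  by apply: powR_mono; rewrite ?s0//; exact: ltW.
apply: (@le_lt_trans _ _ (K * (e / (K + 1)))); first by rewrite ler_wpM2l.
rewrite mulrCA -[ltRHS]mulr1 ltr_pM2l// ltr_pdivrMr//; lra.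
Qed.

Lemma holder_continuous (w : R -> R) K g : 0 < g -> 0 <= K ->
  (forall s t, `|w s - w t| <= K * `|s - t| `^ g) -> continuous w.
Proof.
move=> g0 K0 h x; apply/cvgrPdist_lt => e e0.
have [r r0 hr] := powR_small g0 K0 e0.
near=> t; apply: (le_lt_trans (h _ _)); apply: hr; rewrite normr_ge0 /=.
by near: t; apply: cvgr_dist_le => //; exact: cvg_id.
Unshelve. all: by end_near. Qed.

Lemma holder_within_continuous (D : set R) (w : R -> R) K g : 0 < g -> 0 <= K ->
  (forall s t, D s -> D t -> `|w s - w t| <= K * `|s - t| `^ g) ->
  {within D, continuous w}.
Proof.
move=> g0 K0 h; apply/subspace_continuousP => x Dx; apply/cvgrPdist_lt => e e0.
have [r r0 hr] := powR_small g0 K0 e0.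
near=> t; have Dt : D t by near: t; exact: withinT.
apply: (le_lt_trans (h _ _ Dx Dt)); apply: hr; rewrite normr_ge0 /=.
by near: t; apply: cvg_within; apply: (@cvgr_dist_le _ _ _ (nbhs x) _ id) => //; exact: cvg_id.
Unshelve. all: by end_near. Qed.

Lemma antiderivative_exists c g K (v : R -> R) : 0 <= c -> 0 < g -> 0 <= K ->
  (forall x y, 0 <= x <= c -> 0 <= y <= c -> `|v x - v y| <= K * `|x - y| `^ g) ->
  exists u : R -> R, u 0 = 0 /\
    forall x y, 0 <= x <= c -> 0 <= y <= c ->
      `|u y - u x - v x * (y - x)| <= K * (`|y - x| * `|y - x| `^ g).
Proof.
move=> c0 g0 K0 vh.
(* Composing with this 1-Lipschitz retraction extends v continuously to the line, so the fundamental
   theorem of calculus applies at the endpoints 0 and c as well. *)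
pose clamp t := if t <= 0 then 0 else if c <= t then c else t.
have clamp_in t : 0 <= clamp t <= c.
  rewrite /clamp; have [_|t0] := leP t 0; first by rewrite lexx.
  by have [_|tc] := leP c t; [rewrite lexx c0|rewrite !ltW].
have clamp_id t : 0 <= t <= c -> clamp t = t.
  move=> /andP[t0 tc]; rewrite /clamp; have [t0'|_] := leP t 0; first lra.
  by have [ct|] := leP c t => //; lra.
have clamp_lip s t : `|clamp s - clamp t| <= `|s - t|.
  have h1 := ler_norm (s - t); have h2 := ler_norm (t - s); rewrite distrC in h2.
  have h0 := normr_ge0 (s - t).
  rewrite /clamp ler_norml; have [?|?] := leP s 0; have [?|?] := leP t 0;
    have [?|?] := leP c s; have [?|?] := leP c t; apply/andP; split; lra.
pose w := v \o clamp.
have wc : continuous w.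
  apply: (@holder_continuous w K g) => // s t.
  apply: (le_trans (vh _ _ (clamp_in s) (clamp_in t))); rewrite ler_wpM2l//.
  by apply: powR_mono; [rewrite normr_ge0 clamp_lip|exact: ltW].
(* Integration starts at -1 so that 0 is an interior point; the constant F 0 is subtracted at the
   end. *)
pose F x := (\int[@lebesgue_measure R]_(t in `[(-1)%R, x]) w t)%R.
have dF x : 0 <= x <= c -> is_derive x 1 F (w x).
  move=> xc; have x1 : x < c + 1 by lra.
  have wi : (@lebesgue_measure R).-integrable `[(-1)%R, c + 1] (EFin \o w).
    apply: continuous_compact_integrable; first exact: segment_compact.
    exact: continuous_subspaceT.
  have x0 : -1 < x by lra.
  have [dFx FE] := @continuous_FTC1_closed R w (-1) x (c + 1) x1 wi x0 (wc x).
  have FE' : 'D_1 F x = w x by rewrite -FE derive1E.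
  exact: DeriveDef dFx FE'.
exists (fun x => F x - F 0); split; first by rewrite subrr.
move=> x y xc yc.
have mvt s t : 0 <= s <= c -> 0 <= t <= c -> s <= t ->
    exists2 z, s <= z <= t & F t - F s = w z * (t - s).
  move=> sc tc st; have stc z : z \in `[s, t] -> 0 <= z <= c.
    by rewrite in_itv /=; lra.
  have [z|z zst|z zst ->] := @MVT_segment R F w s t st.
  - by move=> /subset_itv_oo_cc/stc; exact: dF.
  - apply: derivable_within_continuous => y' /stc y'c.
    by have [] := dF _ y'c.
  - by exists z => //; move: zst; rewrite in_itv.
have [z zxy E] : exists2 z, `|z - x| <= `|y - x| & F y - F x = w z * (y - x).
  have [xy|/ltW yx] := leP x y.
    by have [z zxy E] := mvt _ _ xc yc xy; exists z => //; rewrite !ger0_norm; lra.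
  have [z zxy E] := mvt _ _ yc xc yx; exists z; first by rewrite !ler0_norm; lra.
  by rewrite -[LHS]opprB E; ring.
have -> : F y - F 0 - (F x - F 0) - v x * (y - x) = (y - x) * (w z - w x).
  have -> : v x = w x by rewrite /w /= clamp_id.
  by rewrite [RHS]mulrC [RHS]mulrBl -E; ring.
rewrite normrM mulrCA ler_wpM2l//.
apply: (le_trans (vh _ _ (clamp_in z) (clamp_in x))); rewrite ler_wpM2l//.
by apply: powR_mono; [rewrite normr_ge0 (le_trans (clamp_lip _ _))|exact: ltW].
Qed.
End Antiderivative.

(** * Inequalities and affine equations iterated along orbits *)

Section Iteration.
Variables (R : realType) (X : Type) (P : X -> Prop) (G : X -> X).
Hypothesis PG : forall p, P p -> P (G p).

(** Iterating e <= K r + a (e o G) sums a geometric series in r and leaves the remainder eta^n C s.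
    Two weights are needed: r carries the wanted decay and may vanish, while s only serves for a
    crude initial bound of e. With a = 1, the case of the cohomological equation, both weights must
    themselves shrink along orbits. *)
Lemma iter_bound (e r s : X -> R) (a eta K C : R) :
  0 <= a -> 0 <= eta < 1 -> 0 <= K -> 0 <= C ->
  (forall p, P p -> 0 <= r p) ->
  (forall p, P p -> e p <= C * s p) ->
  (forall p, P p -> e p <= K * r p + a * e (G p)) ->
  (forall p, P p -> a * r (G p) <= eta * r p) ->
  (forall p, P p -> a * s (G p) <= eta * s p) ->
  forall p, P p -> e p <= K / (1 - eta) * r p.
Proof.
move=> a0 /andP[eta0 eta1] K0 C0 r0 eC eK rG sG p Pp.
have K' : 0 <= K / (1 - eta) by rewrite divr_ge0//; lra.
apply: (@le_geometric_limit _ eta _ _ (C * s p)); first by rewrite eta0.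
move=> n; elim: n p Pp => [|n IH] p Pp.
  by rewrite expr0 mulr1 ler_wpDl ?eC// mulr_ge0 ?r0.
apply: (le_trans (eK _ Pp)).
have h1 := ler_wpM2l a0 (IH _ (PG Pp)).
have h2 := ler_wpM2l K' (rG _ Pp).
have h3 := ler_wpM2l (mulr_ge0 C0 (exprn_ge0 n eta0)) (sG _ Pp).
have h4 : K * r p = K / (1 - eta) * r p - K / (1 - eta) * (eta * r p).
  by field; rewrite gt_eqF//; lra.
rewrite exprS; lra.
Qed.

(** The solution is the sum of the series with terms a(p) a(G p) ... a(G^(n-1) p) u(G^n p). The
    weight s covers two situations at once: |a| <= q < 1 with s = 1, and a = 1 with s a power of the
    fiber coordinate. *)
Lemma series_solution (u a s : X -> R) (eta C : R) :
  0 <= eta < 1 -> 0 <= C -> (forall p, P p -> 0 <= s p) ->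
  (forall p, P p -> `|u p| <= C * s p) ->
  (forall p, P p -> `|a p| * s (G p) <= eta * s p) ->
  exists Z : X -> R, forall p, P p ->
    Z p = u p + a p * Z (G p) /\ `|Z p| <= C / (1 - eta) * s p.
Proof.
move=> /andP[eta0 eta1] C0 s0 uC aG.
pose t := fix t n p := if n is n'.+1 then a p * t n' (G p) else u p.
have tC n p : P p -> `|t n p| <= geometric (C * s p) eta n.
  elim: n p => [|n IH] p Pp /=; first by rewrite expr0 mulr1 uC.
  rewrite normrM; apply: (le_trans (ler_wpM2l (normr_ge0 _) (IH _ (PG Pp)))) => /=.
  have := ler_wpM2l (mulr_ge0 C0 (exprn_ge0 n eta0)) (aG _ Pp).
  rewrite exprS; lra.
have eta1' : `|eta| < 1 by rewrite ger0_norm.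
have nc p : P p -> cvgn [normed series (t ^~ p)].
  move=> Pp; apply: (@series_le_cvg _ _ (geometric (C * s p) eta)) => //=.
  - by move=> n; rewrite !mulr_ge0 ?exprn_ge0 ?s0.
  - by move=> n; exact: tC.
  - exact: is_cvg_geometric_series.
have tc p : P p -> cvgn (series (t ^~ p)) by move=> /nc; exact: normed_cvg.
exists (fun p => limn (series (t ^~ p))) => p Pp; split.
  apply/cvg_lim => //; rewrite -cvg_shiftS.
  rewrite (_ : [sequence _]_n = fun n => u p + a p * series (t ^~ (G p)) n).
    by apply: cvgD; [exact: cvg_cst|apply: cvgMl_tmp; apply: tc; exact: PG].
  apply/funext => n; rewrite /= /series /= big_nat_recl//= mulr_sumr.
  by [].
apply: (le_trans (lim_series_norm (nc _ Pp))).
have gc := @cvg_geometric_series R (C * s p) eta eta1'.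
have -> : C / (1 - eta) * s p = limn (series (geometric (C * s p) eta)).
  by rewrite (cvg_lim _ gc)//; ring.
apply: lim_series_le; [exact: nc|by apply/cvg_ex; eexists; exact: gc|by move=> n; exact: tC].
Qed.
End Iteration.

(** * Fiberwise Hoelder classes *)

Section Holder.
Variables (R : realType) (B : Type) (tau : B -> B -> R).
Hypothesis tau_ge0 : forall b b', 0 <= tau b b'.
Hypothesis tau_refl : forall b, tau b b = 0.
Implicit Types (c g K L M x y k : R) (u v w f : B -> R -> R) (b : B) (n : nat).

(** [tau] is kept abstract here; it is later the [modulus] of the torus, with respect to which the
    cut-off fiber maps are Lipschitz in the base point. *)
Definition rho b b' x x' := tau b b' + `|x - x'|.

Definition holder_with c g K u := [/\ 0 < g <= 1, 0 <= K,
  forall b x, 0 <= x <= c -> `|u b x| <= K &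
  forall b b' x x', 0 <= x <= c -> 0 <= x' <= c ->
    `|u b x - u b' x'| <= K * rho b b' x x' `^ g].

(* The constant may depend on the exponent g, and g may be lowered at will, so
   that finitely many functions share an exponent. *)
Definition holder c u := \forall g \near 0^'+, exists K, holder_with c g K u.

(* v is the derivative of u along the fibers, expressed by a uniform remainder
   estimate: this form survives functional equations without taking limits. *)
Definition derivative_with c g K u v := [/\ 0 < g <= 1, 0 <= K &
  forall b x y, 0 <= x <= c -> 0 <= y <= c ->
    `|u b y - u b x - v b x * (y - x)| <= K * (`|y - x| * `|y - x| `^ g)].

Definition fiber_derivative c u v := \forall g \near 0^'+, exists K, derivative_with c g K u v.

Definition fiber_bounded c u := exists2 K, 0 <= K & forall b x, 0 <= x <= c -> `|u b x| <= K.

Definition fiber_lipschitz c u := exists2 L, 0 <= L &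
  forall b x y, 0 <= x <= c -> 0 <= y <= c -> `|u b y - u b x| <= L * `|y - x|.

Lemma rho_ge0 b b' x x' : 0 <= rho b b' x x'.
Proof. by rewrite addr_ge0. Qed.

Lemma rho_fiber b x y : rho b b x y = `|x - y|.
Proof. by rewrite /rho tau_refl add0r. Qed.

(** Points with rho > 1 are handled by the sup bound, since rho^g' >= 1 there; for rho <= 1 passing
    from g to a smaller g' only weakens the estimate. *)
Lemma holderI c g K u : 0 < g ->
  (forall b x, 0 <= x <= c -> `|u b x| <= K) ->
  (forall b b' x x', 0 <= x <= c -> 0 <= x' <= c -> rho b b' x x' <= 1 ->
    `|u b x - u b' x'| <= K * rho b b' x x' `^ g) -> holder c u.
Proof.
move=> g0 ub uh; near=> g'; exists (2 * `|K|).
have g'0 : 0 < g' by near: g'; exact: nbhs_right_gt.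
have g'1 : g' <= 1 by near: g'; apply: nbhs_right_le.
have g'g : g' <= g by near: g'; exact: nbhs_right_le.
have KK := ler_norm K; have K0 := normr_ge0 K.
split=> [||b x xc|b b' x x' xc xc']; rewrite ?g'0 ?mulr_ge0//.
  by have := ub b x xc; lra.
have [r1|r1] := leP (rho b b' x x') 1.
  apply: le_trans (uh _ _ _ _ xc xc' r1) _.
  have h1 : rho b b' x x' `^ g <= rho b b' x x' `^ g'.
    by apply: powR_lower; rewrite ?rho_ge0 ?g'0.
  have h2 := powR_ge0 (rho b b' x x') g; nra.
have h1 : 1 <= rho b b' x x' `^ g' by apply: powR_ge1; exact: ltW.
apply: (le_trans (ler_normB _ _)).
have := ub b x xc; have := ub b' x' xc'; nra.
Unshelve. all: by end_near. Qed.

Lemma fiber_derivativeI c g K u v : c <= 1 -> 0 < g -> 0 <= K ->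
  (forall b x y, 0 <= x <= c -> 0 <= y <= c ->
    `|u b y - u b x - v b x * (y - x)| <= K * (`|y - x| * `|y - x| `^ g)) ->
  fiber_derivative c u v.
Proof.
move=> c1 g0 K0 uh; near=> g'; exists K.
have g'0 : 0 < g' by near: g'; exact: nbhs_right_gt.
have g'1 : g' <= 1 by near: g'; apply: nbhs_right_le.
have g'g : g' <= g by near: g'; exact: nbhs_right_le.
split=> [||b x y xc yc]; rewrite ?g'0//.
apply: le_trans (uh _ _ _ xc yc) _.
rewrite ler_wpM2l// ler_wpM2l//; apply: powR_lower; rewrite ?g'0// normr_ge0 /=.
by rewrite ler_norml; apply/andP; split; lra.
Unshelve. all: by end_near. Qed.

Lemma holder_ext c u u' : (forall b x, 0 <= x <= c -> u b x = u' b x) ->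
  holder c u -> holder c u'.
Proof.
move=> E; apply: filterS => g [K [g01 K0 ub uh]]; exists K.
split=> //; first by move=> b x xc; rewrite -E//; exact: ub.
by move=> b b' x x' xc xc'; rewrite -!E//; exact: uh.
Qed.

Lemma fiber_derivative_ext c u u' v v' : (forall b x, 0 <= x <= c -> u b x = u' b x) ->
  (forall b x, 0 <= x <= c -> v b x = v' b x) -> fiber_derivative c u v -> fiber_derivative c u' v'.
Proof.
move=> Eu Ev; apply: filterS => g [K [g01 K0 uh]]; exists K.
by split=> //; move=> b x y xc yc; rewrite -!Eu// -Ev//; exact: uh.
Qed.

Lemma holder_ex c u : holder c u -> exists g K, holder_with c g K u.
Proof. by move=> h; apply: (@filter_ex _ (0^'+ : set_system R) _ _ h). Qed.

Lemma fiber_derivative_ex c u v : fiber_derivative c u v -> exists g K, derivative_with c g K u v.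
Proof. by move=> h; apply: (@filter_ex _ (0^'+ : set_system R) _ _ h). Qed.

Lemma holder_bounded c u : holder c u -> fiber_bounded c u.
Proof. by move=> /holder_ex[g [K [_ K0 ub _]]]; exists K. Qed.

Lemma fiber_derivative_lipschitz c u v : c <= 1 -> fiber_bounded c v ->
    fiber_derivative c u v -> fiber_lipschitz c u.
Proof.
move=> c1 [M M0 vM] /fiber_derivative_ex[g [K [g01 K0 uh]]]; exists (M + K); first lra.
move=> b x y xc yc.
have h1 : `|y - x| `^ g <= 1.
  apply: powR_le1; last lra.
  by rewrite normr_ge0 ler_norml; apply/andP; split; lra.
have h2 := uh b x y xc yc.
have h3 : `|v b x * (y - x)| <= M * `|y - x| by apply: ler_normM => //; exact: vM.
have -> : u b y - u b x = (u b y - u b x - v b x * (y - x)) + v b x * (y - x) by ring.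
apply: (le_trans (ler_normD _ _)); rewrite mulrDl addrC; apply: lerD => //.
apply: (le_trans h2); rewrite ler_wpM2l// -[leRHS]mulr1 ler_wpM2l//.
Qed.

Lemma holder_cst c (r : R) : holder c (fun _ _ => r).
Proof.
apply: (@holderI _ 1 `|r|) => // b b' x x' _ _ _.
by rewrite subrr normr0 mulr_ge0 ?powR_ge0.
Qed.

Lemma holder_id c : c <= 1 -> holder c (fun _ x => x).
Proof.
move=> c1; apply: (@holderI _ 1 1) => // [b x xc|b b' x x' _ _ _].
  by rewrite ger0_norm; lra.
by rewrite mul1r powRr1 ?rho_ge0// lerDr.
Qed.

Lemma fiber_derivative_cst c (r : R) : c <= 1 -> fiber_derivative c (fun _ _ => r) (fun _ _ => 0).
Proof.
move=> c1; apply: (@fiber_derivativeI _ 1 0) => // b x y _ _.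
by rewrite subrr mul0r subr0 normr0 mul0r.
Qed.

Lemma fiber_derivative_id c : c <= 1 -> fiber_derivative c (fun _ x => x) (fun _ _ => 1).
Proof.
move=> c1; apply: (@fiber_derivativeI _ 1 0) => // b x y _ _.
by rewrite mul1r subrr normr0 mul0r.
Qed.

Lemma holder_add c u v : holder c u -> holder c v -> holder c (fun b x => u b x + v b x).
Proof.
apply: filterS2 => g [K [g01 K0 ub uh]] [M [_ M0 vb vh]]; exists (K + M).
split=> // [|b x xc|b b' x x' xc xc']; first lra.
  by apply: (le_trans (ler_normD _ _)); apply: lerD; [exact: ub|exact: vb].
have -> : u b x + v b x - (u b' x' + v b' x') = (u b x - u b' x') + (v b x - v b' x').
  by ring.
apply: (le_trans (ler_normD _ _)).
by rewrite mulrDl; apply: lerD; [exact: uh|exact: vh].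
Qed.

Lemma holder_mul c u v : holder c u -> holder c v -> holder c (fun b x => u b x * v b x).
Proof.
apply: filterS2 => g [K [g01 K0 ub uh]] [M [_ M0 vb vh]]; exists (2 * (K * M)).
have KM : 0 <= K * M by rewrite mulr_ge0.
split=> // [|b x xc|b b' x x' xc xc']; first lra.
  by apply: (le_trans (ler_normM (ub _ _ xc) (vb _ _ xc))); lra.
have -> : u b x * v b x - u b' x' * v b' x' =
  (u b x - u b' x') * v b x + u b' x' * (v b x - v b' x') by ring.
apply: (le_trans (ler_normD _ _)).
have h1 := ler_normM (uh b b' _ _ xc xc') (vb b _ xc).
have h2 := ler_normM (ub b' _ xc') (vh b b' _ _ xc xc').
lra.
Qed.

Lemma fiber_derivative_add c u v u' v' : fiber_derivative c u u' -> fiber_derivative c v v' ->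
  fiber_derivative c (fun b x => u b x + v b x) (fun b x => u' b x + v' b x).
Proof.
apply: filterS2 => g [K [g01 K0 uh]] [M [_ M0 vh]]; exists (K + M).
split=> // [|b x y xc xc']; first lra.
have -> : u b y + v b y - (u b x + v b x) - (u' b x + v' b x) * (y - x) =
  (u b y - u b x - u' b x * (y - x)) + (v b y - v b x - v' b x * (y - x)) by ring.
apply: (le_trans (ler_normD _ _)).
by rewrite mulrDl; apply: lerD; [exact: uh|exact: vh].
Qed.

Lemma fiber_derivative_mul c u v u' v' : c <= 1 -> fiber_bounded c u -> fiber_bounded c v ->
    fiber_bounded c u' -> fiber_lipschitz c v ->
  fiber_derivative c u u' -> fiber_derivative c v v' ->
  fiber_derivative c (fun b x => u b x * v b x) (fun b x => u' b x * v b x + u b x * v' b x).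
Proof.
move=> c1 [U U0 uU] [V V0 vV] [U' U'0 uU'] [L L0 vL].
apply: filterS2 => g [K [g01 K0 uh]] [M [_ M0 vh]]; exists (K * V + U' * L + U * M).
split=> // [|b x y xc xc']; first by rewrite !addr_ge0// mulr_ge0.
have -> : u b y * v b y - (u b x * v b x) - (u' b x * v b x + u b x * v' b x) * (y - x) =
  (u b y - u b x - u' b x * (y - x)) * v b y + u' b x * ((y - x) * (v b y - v b x))
  + u b x * (v b y - v b x - v' b x * (y - x)) by ring.
set h := `|y - x| * _.
have h1 := ler_normM (uh b _ _ xc xc') (vV b _ xc').
have h2 := ler_normM (uU b _ xc) (vh b _ _ xc xc').
(* The cross term is quadratic in y - x, and |y - x| <= |y - x|^g because the interval has length at
   most 1. *)
have h3 : `|u' b x * ((y - x) * (v b y - v b x))| <= U' * (L * h).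
  apply: ler_normM; first exact: uU'.
  rewrite normrM mulrC; apply: (le_trans (ler_wpM2r _ (vL b _ _ xc xc'))) => //.
  rewrite -mulrA ler_wpM2l// ler_wpM2l//; apply: powR_self => //.
  by rewrite normr_ge0 ler_norml; apply/andP; split; lra.
rewrite -/h in h1 h2; apply: (le_trans (ler_normD _ _)).
apply: (le_trans (lerD (ler_normD _ _) (lexx _))); lra.
Qed.

(** The exponents multiply. The base map contributes at most L rho, which is below L rho^e for rho
    <= 1. *)
Lemma holder_comp c c' L (T : B -> B) u f : 0 <= L ->
  (forall b b', tau (T b) (T b') <= L * tau b b') ->
  (forall b x, 0 <= x <= c -> 0 <= f b x <= c') ->
  holder c' u -> holder c f -> holder c (fun b x => u (T b) (f b x)).
Proof.
move=> L0 TL fc /holder_ex[g [K [/andP[g0 g1] K0 ub uh]]].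
move=> /holder_ex[e [M [/andP[e0 e1] M0 fb fh]]].
apply: (@holderI _ (e * g) (K + K * (L + M) `^ g)); first by rewrite mulr_gt0.
  move=> b x xc; apply: (le_trans (ub _ _ (fc _ _ xc))).
  by rewrite lerDl mulr_ge0 ?powR_ge0.
move=> b b' x x' xc xc' r1; apply: (le_trans (uh _ _ _ _ (fc _ _ xc) (fc _ _ xc'))).
rewrite mulrDl; apply: ler_wpDl; first by rewrite mulr_ge0 ?powR_ge0.
rewrite -mulrA ler_wpM2l// powRrM -powRM ?powR_ge0//; last lra.
apply: powR_mono; last lra.
rewrite rho_ge0 /= mulrDl; apply: lerD; last exact: fh.
apply: (le_trans (TL _ _)); rewrite ler_wpM2l//.
apply: (@le_trans _ _ (rho b b' x x')); first by rewrite /rho lerDl.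
by apply: powR_self; rewrite ?rho_ge0 ?e0.
Qed.

Lemma fiber_derivative_comp c c' (T : B -> B) u v f f' : c <= 1 -> fiber_bounded c' v ->
    fiber_lipschitz c f ->
  (forall b x, 0 <= x <= c -> 0 <= f b x <= c') ->
  fiber_derivative c' u v -> fiber_derivative c f f' ->
  fiber_derivative c (fun b x => u (T b) (f b x)) (fun b x => v (T b) (f b x) * f' b x).
Proof.
move=> c1 [V V0 vV] [L L0 fL] fc.
apply: filterS2 => g [K [/andP[g0 g1] K0 uh]] [M [_ M0 fh]].
exists (K * (L * L `^ g) + V * M); split; rewrite ?g0//.
  by rewrite !(addr_ge0, mulr_ge0)// powR_ge0.
move=> b x y xc yc.
have -> : u (T b) (f b y) - u (T b) (f b x) - v (T b) (f b x) * f' b x * (y - x) =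
  (u (T b) (f b y) - u (T b) (f b x) - v (T b) (f b x) * (f b y - f b x))
  + v (T b) (f b x) * (f b y - f b x - f' b x * (y - x)) by ring.
apply: (le_trans (ler_normD _ _)); rewrite mulrDl; apply: lerD.
  apply: (le_trans (uh _ _ _ (fc _ _ xc) (fc _ _ yc))).
  rewrite -!mulrA ler_wpM2l//.
  have -> : L * (L `^ g * (`|y - x| * `|y - x| `^ g)) =
    (L * `|y - x|) * (L * `|y - x|) `^ g by rewrite powRM//; ring.
  apply: ler_pM => //; rewrite ?powR_ge0 ?fL//; apply: powR_mono; last lra.
  by rewrite normr_ge0 fL.
by rewrite -mulrA; apply: ler_normM; [exact: vV (fc _ _ xc)|exact: fh].
Qed.

Lemma holder_outer c L p0 (P : R -> Prop) (G : R -> R) u : 0 <= L -> P p0 ->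
  (forall s t, P s -> P t -> `|G t - G s| <= L * `|t - s|) ->
  (forall b x, 0 <= x <= c -> P (u b x)) ->
  holder c u -> holder c (fun b x => G (u b x)).
Proof.
move=> L0 Pp0 GL uP; apply: filterS => g [K [g01 K0 ub uh]].
exists (`|G p0| + L * (K + `|p0|) + L * K).
split=> // [|b x xc|b b' x x' xc xc'].
- by rewrite !(addr_ge0, mulr_ge0).
- have -> : G (u b x) = G p0 + (G (u b x) - G p0) by ring.
  apply: (le_trans (ler_normD _ _)); rewrite -addrA lerD2l.
  apply: (le_trans (GL _ _ Pp0 (uP _ _ xc))); apply: ler_wpDr; first by rewrite mulr_ge0.
  rewrite ler_wpM2l//; apply: (le_trans (ler_normB _ _)); rewrite lerD2r; exact: ub.
- apply: (le_trans (GL _ _ (uP _ _ xc') (uP _ _ xc))).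
  rewrite mulrDl; apply: ler_wpDl;
      first by rewrite mulr_ge0 ?powR_ge0// addr_ge0// mulr_ge0// addr_ge0.
  by rewrite -mulrA ler_wpM2l//; exact: uh.
Qed.

Lemma fiber_derivative_outer c L M (P : R -> Prop) (G G' : R -> R) u v : c <= 1 -> 0 <= L ->
    0 <= M ->
  (forall s t, P s -> P t -> `|G t - G s - G' s * (t - s)| <= L * (t - s) ^+ 2) ->
  (forall s, P s -> `|G' s| <= M) ->
  (forall b x, 0 <= x <= c -> P (u b x)) -> fiber_lipschitz c u -> fiber_derivative c u v ->
  fiber_derivative c (fun b x => G (u b x)) (fun b x => G' (u b x) * v b x).
Proof.
move=> c1 L0 M0 GL GM uP [U U0 uU].
apply: filterS => g [K [g01 K0 uh]]; exists (L * U ^+ 2 + M * K).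
split=> // [|b x y xc yc]; first by rewrite !(addr_ge0, mulr_ge0, exprn_ge0).
have -> : G (u b y) - G (u b x) - G' (u b x) * v b x * (y - x) =
  (G (u b y) - G (u b x) - G' (u b x) * (u b y - u b x))
  + G' (u b x) * (u b y - u b x - v b x * (y - x)) by ring.
apply: (le_trans (ler_normD _ _)); rewrite mulrDl; apply: lerD.
  apply: (le_trans (GL _ _ (uP _ _ xc) (uP _ _ yc))); rewrite -mulrA ler_wpM2l//.
  rewrite -[leLHS]real_normK ?num_real//.
  apply: (@le_trans _ _ ((U * `|y - x|) ^+ 2)).
    by apply: lerXn2r; rewrite ?nnegrE ?mulr_ge0// uU.
  rewrite exprMn ler_wpM2l ?exprn_ge0// expr2 ler_wpM2l//; apply: powR_self => //.
  by rewrite normr_ge0 ler_norml; apply/andP; split; lra.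
by rewrite -mulrA; apply: ler_normM; [exact: GM (uP _ _ xc)|exact: uh].
Qed.


(** The analogue of C^n in x, with all fiber derivatives jointly Hoelder in (b, x). Derivatives are
    quantified existentially because they will arise as solutions of functional equations rather
    than as limits. *)
Fixpoint holder_class n c u : Prop :=
  if n is n'.+1 then holder c u /\ exists2 v, fiber_derivative c u v & holder_class n' c v
  else holder c u.

Lemma holder_class_holder n c u : holder_class n c u -> holder c u.
Proof. by case: n => [|n] //= []. Qed.

Lemma holder_classW n c u : holder_class n.+1 c u -> holder_class n c u.
Proof.
elim: n u => [|n IH] u [hu [v uv hv]] //=.
by split=> //; exists v => //; exact: IH.
Qed.

Lemma holder_class_lipschitz n c u : c <= 1 -> holder_class n.+1 c u -> fiber_lipschitz c u.
Proof.
move=> c1 [_ [v uv /holder_class_holder/holder_bounded hv]];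
    exact: fiber_derivative_lipschitz hv uv.
Qed.

Lemma holder_class_ext n c u u' : (forall b x, 0 <= x <= c -> u b x = u' b x) ->
  holder_class n c u -> holder_class n c u'.
Proof.
move=> E; case: n => [|n] /=; first exact: holder_ext.
move=> [hu [v uv hv]]; split; first exact: holder_ext hu.
by exists v => //; apply: fiber_derivative_ext uv.
Qed.

Lemma holder_class_cst n c (r : R) : c <= 1 -> holder_class n c (fun _ _ => r).
Proof.
move=> c1; elim: n r => [|n IH] r /=; first exact: holder_cst.
split; first exact: holder_cst.
by exists (fun _ _ => 0); [exact: fiber_derivative_cst|exact: IH].
Qed.

Lemma holder_class_id n c : c <= 1 -> holder_class n c (fun _ x => x).
Proof.
move=> c1; case: n => [|n] /=; first exact: holder_id.
split; first exact: holder_id.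
by exists (fun _ _ => 1); [exact: fiber_derivative_id|exact: holder_class_cst].
Qed.

Lemma holder_class_base n c (l : B -> R) : c <= 1 -> holder c (fun b _ => l b) ->
  holder_class n c (fun b _ => l b).
Proof.
move=> c1 hl; case: n => [|n] //=; split=> //; exists (fun _ _ => 0).
  apply: (@fiber_derivativeI _ 1 0) => // b x y _ _.
  by rewrite subrr mul0r subr0 normr0 mul0r.
exact: holder_class_cst.
Qed.

Lemma holder_class_add n c u v : holder_class n c u -> holder_class n c v ->
    holder_class n c (fun b x => u b x + v b x).
Proof.
elim: n u v => [|n IH] u v /=; first exact: holder_add.
move=> [hu [u' uu' hu']] [hv [v' vv' hv']]; split; first exact: holder_add.
exists (fun b x => u' b x + v' b x); first exact: fiber_derivative_add.
exact: IH.
Qed.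

Lemma holder_class_mul n c u v : c <= 1 -> holder_class n c u -> holder_class n c v ->
    holder_class n c (fun b x => u b x * v b x).
Proof.
move=> c1; elim: n u v => [|n IH] u v /=; first exact: holder_mul.
move=> U V; have hfv := holder_class_lipschitz c1 V; have [U0 V0] :=
    (holder_classW U, holder_classW V).
move: U V => [hu [u' uu' hu']] [hv [v' vv' hv']]; split; first exact: holder_mul.
exists (fun b x => u' b x * v b x + u b x * v' b x).
  by apply: fiber_derivative_mul => //; apply: holder_bounded;
      [exact: hu|exact: hv|exact: holder_class_holder hu'].
by apply: holder_class_add; exact: IH.
Qed.

Lemma holder_class_opp n c u : c <= 1 -> holder_class n c u -> holder_class n c (fun b x =>
    - u b x).
Proof.
move=> c1 hu; apply: (@holder_class_ext _ _ (fun b x => (-1) * u b x)) => [b x _|].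
  by rewrite mulN1r.
by apply: holder_class_mul => //; exact: holder_class_cst.
Qed.

Lemma holder_class_comp n c c' L (T : B -> B) u f : c <= 1 -> 0 <= L ->
  (forall b b', tau (T b) (T b') <= L * tau b b') ->
  (forall b x, 0 <= x <= c -> 0 <= f b x <= c') ->
  holder_class n c' u -> holder_class n c f -> holder_class n c (fun b x => u (T b) (f b x)).
Proof.
move=> c1 L0 TL fc; elim: n u f fc => [|n IH] u f fc /=.
  by move=> hu hf; exact: (holder_comp L0 TL fc hu hf).
move=> [hu [v uv hv]] F; have F0 := holder_classW F; have Ff := holder_class_lipschitz c1 F.
move: F => [hf [f' ff' hf']]; split; first exact: (holder_comp L0 TL fc hu hf).
exists (fun b x => v (T b) (f b x) * f' b x).
  by apply: fiber_derivative_comp uv ff' => //; apply: holder_bounded (holder_class_holder hv).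
by apply: holder_class_mul => //; exact: IH.
Qed.

Lemma holder_class_exp n c u : c <= 1 -> holder_class n c u -> holder_class n c (fun b x =>
    expR (u b x)).
Proof.
move=> c1 U; have [K K0 uK] := holder_bounded (holder_class_holder U).
have uK' b x : 0 <= x <= c -> u b x <= K.
  by move=> /(uK b); exact/le_trans/ler_norm.
have eK := expR_ge0 K.
have hexp : holder c u -> holder c (fun b x => expR (u b x)).
  move=> hu; apply: (@holder_outer _ (expR K) 0 (fun s => s <= K)) => //.
  by move=> s t sK tK; exact: expR_lip.
elim: n U => [|n IH] //= U; have hn := IH (holder_classW U); have uf := holder_class_lipschitz c1 U.
move: U => [hu [v uv hv]]; split; first exact: hexp.
exists (fun b x => expR (u b x) * v b x); last exact: holder_class_mul.
apply: (@fiber_derivative_outer _ (4 * expR K) (expR K) (fun s => s <= K)) => //.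
- by move=> s t sK tK; exact: expR_quad.
- by move=> s sK; rewrite ger0_norm ?expR_ge0// ler_expR.
Qed.

Lemma holder_class_ln n c k u : c <= 1 -> 0 < k -> (forall b x, 0 <= x <= c -> k <= u b x) ->
  holder_class n c u -> holder_class n c (fun b x => ln (u b x)).
Proof.
move=> c1 k0 ku U; have k'0 : 0 <= k^-1 by rewrite invr_ge0 ltW.
have hln : holder c u -> holder c (fun b x => ln (u b x)).
  move=> hu; apply: (@holder_outer _ (k^-1) k (fun s => k <= s)) => //.
  by move=> s t sK tK; exact: ln_lip.
elim: n U => [|n IH] //= U; have hn := IH (holder_classW U); have uf := holder_class_lipschitz c1 U.
move: U => [hu [v uv hv]]; split; first exact: hln.
exists (fun b x => (u b x)^-1 * v b x).
  apply: (@fiber_derivative_outer _ ((k^-1) ^+ 2) (k^-1) (fun s => k <= s) (@ln R) (fun s =>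
      s^-1)) => //.
  - by rewrite exprn_ge0.
  - by move=> s t sK tK; exact: ln_quad.
  - move=> s ks; have s0 := lt_le_trans k0 ks; have s0' := ltW s0.
    by rewrite ger0_norm ?invr_ge0// lef_pV2 ?posrE.
apply: holder_class_mul => //.
(* Writing 1/u as exp(- ln u) brings the reciprocal under the induction hypothesis for ln. *)
apply: (@holder_class_ext _ _ (fun b x => expR (- ln (u b x)))) => [b x xc|].
  by rewrite expRN lnK// posrE (lt_le_trans k0)// ku.
by apply: holder_class_exp => //; exact: holder_class_opp.
Qed.

Lemma holder_class_inv n c k u : c <= 1 -> 0 < k -> (forall b x, 0 <= x <= c -> k <= u b x) ->
  holder_class n c u -> holder_class n c (fun b x => (u b x)^-1).
Proof.
move=> c1 k0 ku U; apply: (@holder_class_ext _ _ (fun b x => expR (- ln (u b x)))) => [b x xc|].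
  by rewrite expRN lnK// posrE (lt_le_trans k0)// ku.
by apply: holder_class_exp => //; apply: holder_class_opp => //; exact: holder_class_ln ku U.
Qed.

(* Bisection halves the step but divides the sum of the error terms by [2 `^ g]. *)
Lemma mean_value_le c g K M (u v : R -> R) : 0 < g -> 0 <= K ->
  (forall x y, 0 <= x <= c -> 0 <= y <= c ->
    `|u y - u x - v x * (y - x)| <= K * (`|y - x| * `|y - x| `^ g)) ->
  (forall x, 0 <= x <= c -> `|v x| <= M) ->
  forall x y, 0 <= x <= c -> 0 <= y <= c -> `|u y - u x| <= M * `|y - x|.
Proof.
move=> g0 K0 uv vM x y xc yc; set q := (2^-1 : R) `^ g.
have q01 : 0 <= q < 1.
  by rewrite powR_ge0 /=; apply: powR_lt1 => //; apply/andP; split; lra.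
apply: (@le_geometric_limit _ q _ _ (K * (`|y - x| * `|y - x| `^ g))) => // n.
elim: n x y xc yc => [|n IH] x y xc yc.
  rewrite expr0 mulr1.
  have -> : u y - u x = v x * (y - x) + (u y - u x - v x * (y - x)) by ring.
  apply: (le_trans (ler_normD _ _)); apply: lerD; last exact: uv.
  by apply: ler_normM => //; exact: vM.
pose m := (x + y) / 2.
have mc : 0 <= m <= c by rewrite /m; apply/andP; split; lra.
have h1 := IH _ _ xc mc; have h2 := IH _ _ mc yc.
have E1 : `|m - x| = `|y - x| / 2.
  have -> : m - x = (y - x) / 2 by rewrite /m; field.
  by rewrite normrM (@ger0_norm _ 2^-1)// invr_ge0.
have E2 : `|y - m| = `|y - x| / 2.
  have -> : y - m = (y - x) / 2 by rewrite /m; field.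
  by rewrite normrM (@ger0_norm _ 2^-1)// invr_ge0.
rewrite E1 powRM ?invr_ge0// -/q in h1; rewrite E2 powRM ?invr_ge0// -/q in h2.
have -> : u y - u x = (u m - u x) + (u y - u m) by ring.
apply: (le_trans (ler_normD _ _)); rewrite exprS; lra.
Qed.

Lemma fiber_derivative_mean_value c M u v : fiber_derivative c u v ->
    (forall b x, 0 <= x <= c -> `|v b x| <= M) ->
  forall b x y, 0 <= x <= c -> 0 <= y <= c -> `|u b y - u b x| <= M * `|y - x|.
Proof.
move=> /fiber_derivative_ex[g [K [/andP[g0 _] K0 uv]]] vM b.
by apply: (mean_value_le g0 K0 (uv b)) => x; exact: vM.
Qed.

(** Subtracting a x, with a the midpoint of [k, M], leaves a derivative of absolute value at most (M
    - k)/2; the symmetric mean value bound then becomes the two-sided one. *)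
Lemma fiber_derivative_increment c k M u v : c <= 1 -> fiber_derivative c u v ->
  (forall b x, 0 <= x <= c -> k <= v b x <= M) ->
  forall b x y, 0 <= x <= c -> 0 <= y <= c -> x <= y ->
  k * (y - x) <= u b y - u b x <= M * (y - x).
Proof.
move=> c1 uv vM b x y xc yc xy; pose a := (k + M) / 2.
have h : fiber_derivative c (fun b x => u b x + (- a) * x) (fun b x =>
    v b x + ((0 * x) + (- a) * 1)).
  apply: fiber_derivative_add => //; apply: fiber_derivative_mul => //.
  - exact: holder_bounded (holder_cst _ _).
  - exact: holder_bounded (holder_id c1).
  - exact: holder_bounded (holder_cst _ _).
  - by exists 1 => // b' s t _ _; rewrite mul1r.
  - exact: fiber_derivative_cst.
  - exact: fiber_derivative_id.
have := fiber_derivative_mean_value h (M := (M - k) / 2) _ b xc yc.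
rewrite (ger0_norm (x := y - x)) ?subr_ge0// => H.
have {}H := H _; have /H : forall b0 x0, 0 <= x0 <= c ->
    `|v b0 x0 + (0 * x0 + - a * 1)| <= (M - k) / 2.
  move=> b' s sc; have := vM b' s sc; rewrite /a => ?.
  by rewrite ler_norml; apply/andP; split; lra.
rewrite ler_norml /a => /andP[h1 h2]; apply/andP; split; lra.
Qed.

Lemma fiber_derivative_unique c u v w : fiber_derivative c u w -> fiber_derivative c v w ->
    (forall b, u b 0 = v b 0) ->
  forall b x, 0 <= x <= c -> u b x = v b x.
Proof.
move=> uw vw u0 b x xc.
have [g [[K [g01 K0 uh]] [M [_ M0 vh]]]] :=
  @filter_ex _ (0^'+ : set_system R) _ _ (filterI uw vw).
have /andP[g0 _] := g01.
suff : `|(u b x - v b x) - (u b 0 - v b 0)| <= 0 * `|x - 0|.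
  by rewrite mul0r u0 subrr subr0 normr_le0 subr_eq0 => /eqP.
apply: (@mean_value_le c g (K + M) 0 (fun x => u b x - v b x) (fun=> 0)) => //.
- by rewrite addr_ge0.
- move=> s t sc tc; have -> : u b t - v b t - (u b s - v b s) - 0 * (t - s)
    = (u b t - u b s - w b s * (t - s)) - (v b t - v b s - w b s * (t - s)) by ring.
  by apply: (le_trans (ler_normB _ _)); rewrite mulrDl; apply: lerD; [exact: uh|exact: vh].
- by move=> s _; rewrite normr0.
- by rewrite lexx; lra.
Qed.

(** For fixed b and b', the function u b - u b' vanishes at 0 and has derivative v b - v b', of size
    at most K tau^g; the mean value bound on [0, x'] transfers this to u. *)
Lemma holder_antider c u v : 0 <= c <= 1 -> holder c v -> fiber_derivative c u v ->
  (forall b, u b 0 = 0) -> holder c u.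
Proof.
move=> /andP[c0 c1] hv uv u0.
have [g [K [g01 K0 vb vh]]] := holder_ex hv.
have /andP[g0 g1] := g01.
have [e [M [/andP[e0 _] M0 uh]]] := fiber_derivative_ex uv.
have uL := fiber_derivative_mean_value uv vb.
apply: (@holderI _ g (K + K)) => // [b x xc|b b' x x' xc xc' r1].
  have := uL b 0 x _ xc; rewrite u0 !subr0 => /(_ _).
  have /[swap] /[apply] : 0 <= (0:R) <= c by rewrite lexx.
  rewrite (ger0_norm (x := x)); last lra.
  by move/le_trans; apply; nra.
have h1 : `|u b x - u b x'| <= K * rho b b' x x' `^ g.
  apply: (le_trans (uL _ _ _ xc' xc)); rewrite ler_wpM2l//.
  apply: (@le_trans _ _ (rho b b' x x')); first by rewrite /rho lerDr.
  by apply: powR_self => //; rewrite rho_ge0.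
have h2 : `|u b x' - u b' x'| <= K * rho b b' x x' `^ g.
  suff h : `|(u b x' - u b' x') - (u b 0 - u b' 0)| <= K * rho b b' x x' `^ g * `|x' - 0|.
    rewrite !u0 !subr0 in h; apply: (le_trans h); rewrite (ger0_norm (x := x')); last lra.
    by rewrite ler_piMr ?mulr_ge0 ?powR_ge0//; lra.
  apply: (@mean_value_le c e (M + M) _
    (fun x => u b x - u b' x) (fun x => v b x - v b' x)) => //.
  - by rewrite addr_ge0.
  - move=> s t sc tc; have -> : u b t - u b' t - (u b s - u b' s) - (v b s - v b' s) * (t - s)
      = (u b t - u b s - v b s * (t - s)) - (u b' t - u b' s - v b' s * (t - s)) by ring.
    by apply: (le_trans (ler_normB _ _)); rewrite mulrDl; apply: lerD; exact: uh.
  - move=> s sc; apply: (le_trans (vh _ _ _ _ sc sc)); rewrite ler_wpM2l//.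
    by apply: powR_mono; [rewrite rho_ge0//= /rho subrr normr0 addr0 lerDl|lra].
  - by rewrite lexx.
have -> : u b x - u b' x' = (u b x - u b x') + (u b x' - u b' x') by ring.
by apply: (le_trans (ler_normD _ _)); rewrite mulrDl; apply: lerD.
Qed.

(** * Fiberwise inverse functions *)

Section Inverse.
Variables (c c' k : R) (u v G : B -> R -> R).
Hypotheses (c1 : c <= 1) (c'1 : c' <= 1) (k0 : 0 < k).
Hypothesis uk : forall b x y, 0 <= x <= c -> 0 <= y <= c ->
  k * `|y - x| <= `|u b y - u b x|.
Hypothesis Gc : forall b y, 0 <= y <= c' -> 0 <= G b y <= c.
Hypothesis uG : forall b y, 0 <= y <= c' -> u b (G b y) = y.

Lemma inverse_lip b x y : 0 <= x <= c' -> 0 <= y <= c' ->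
  `|G b y - G b x| <= k^-1 * `|y - x|.
Proof.
move=> xc yc; have := uk b (Gc b xc) (Gc b yc); rewrite !uG//.
by rewrite ler_pdivlMl.
Qed.

(** The maps u b and u b' are compared at the same point G b' x', where the second takes the value
    x'. Their difference there and |x - x'|, divided by k, bound the variation of G. *)
Lemma holder_inverse : holder c u -> holder c' G.
Proof.
move=> /holder_ex[g [K [g01 K0 ub uh]]]; have /andP[g0 g1] := g01.
have k'0 : 0 <= k^-1 by rewrite invr_ge0 ltW.
apply: (@holderI _ g (1 + k^-1 * (1 + K))) => // [b x xc|b b' x x' xc xc' r1].
  have := Gc b xc => ?; rewrite ger0_norm; last lra.
  have : 0 <= k^-1 * (1 + K) by rewrite mulr_ge0//; lra.
  by move=> ?; apply: ler_wpDr => //; case/andP: (Gc b xc) => _ h; exact: (le_trans h c1).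
rewrite mulrDl mul1r; apply: ler_wpDl; first exact: powR_ge0.
rewrite -mulrA ler_pdivlMl// distrC; apply: (le_trans (uk b _ _)); [exact: Gc|exact: Gc|].
rewrite (uG b xc).
have -> : u b (G b' x') - x = (u b (G b' x') - u b' (G b' x')) - (x - x').
  by rewrite (uG b' xc'); ring.
apply: (le_trans (ler_normB _ _)); rewrite mulrDl mul1r addrC; apply: lerD.
  apply: (@le_trans _ _ (rho b b' x x')); first by rewrite /rho lerDr.
  by apply: powR_self => //; rewrite rho_ge0.
apply: (le_trans (uh _ _ _ _ (Gc _ xc') (Gc _ xc'))); rewrite ler_wpM2l//.
by apply: powR_mono; [rewrite rho_ge0//= /rho subrr normr0 addr0 lerDl|lra].
Qed.

Hypothesis vk : forall b x, 0 <= x <= c -> k <= v b x.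

Lemma fiber_derivative_inverse : fiber_derivative c u v -> fiber_derivative c' G (fun b y =>
    (v b (G b y))^-1).
Proof.
move=> /fiber_derivative_ex[g [K [/andP[g0 g1] K0 uh]]].
have k'0 : 0 <= k^-1 by rewrite invr_ge0 ltW.
apply: (@fiber_derivativeI _ g (k^-1 * (K * (k^-1 * k^-1 `^ g)))) => //.
  by rewrite !mulr_ge0// powR_ge0.
move=> b x y xc yc; have v0 := lt_le_trans k0 (vk b (Gc b xc)).
have -> : G b y - G b x - (v b (G b x))^-1 * (y - x) =
   - (v b (G b x))^-1 * (u b (G b y) - u b (G b x) - v b (G b x) * (G b y - G b x)).
  by rewrite !uG//; field; rewrite gt_eqF.
rewrite -!mulrA; apply: ler_normM.
  by have v0' := ltW v0; rewrite normrN ger0_norm ?invr_ge0// lef_pV2 ?posrE// vk// Gc.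
apply: (le_trans (uh _ _ _ (Gc _ xc) (Gc _ yc))); rewrite ler_wpM2l//.
have -> : k^-1 * (k^-1 `^ g * (`|y - x| * `|y - x| `^ g)) =
  (k^-1 * `|y - x|) * (k^-1 * `|y - x|) `^ g by rewrite powRM//; ring.
have h := inverse_lip b xc yc.
by apply: ler_pM; rewrite ?powR_ge0//; apply: powR_mono; [rewrite normr_ge0|lra].
Qed.

(** Bootstrap on G' = 1/(v o G): if G' has class n then G has class n + 1, hence so have v o G and
    its reciprocal. *)
Lemma holder_class_inverse n : holder c u -> fiber_derivative c u v -> holder_class n c v ->
  holder_class n c' (fun b y => (v b (G b y))^-1).
Proof.
move=> hu uv; elim: n => [|n IH] V.
  apply: (@holder_class_inv 0 c' k) => // [b x xc|]; first by rewrite vk// Gc.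
  by apply: (@holder_class_comp 0 c' c 1 id v G) => // [b b'|];
      [rewrite mul1r|exact: holder_inverse].
apply: (@holder_class_inv n.+1 c' k) => // [b x xc|]; first by rewrite vk// Gc.
apply: (@holder_class_comp n.+1 c' c 1 id v G) => // [b b'|]; first by rewrite mul1r.
split; first exact: holder_inverse.
by eexists; [exact: fiber_derivative_inverse|apply: IH; exact: holder_classW].
Qed.

End Inverse.

Lemma antider_exists c v : 0 <= c <= 1 -> holder c v ->
  exists u, [/\ fiber_derivative c u v, holder c u & forall b, u b 0 = 0].
Proof.
move=> /andP[c0 c1] hv; have [g [K [g01 K0 vb vh]]] := holder_ex hv.
have /andP[g0 _] := g01.
have H b : exists u : R -> R, u 0 = 0 /\ forall x y, 0 <= x <= c -> 0 <= y <= c ->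
      `|u y - u x - v b x * (y - x)| <= K * (`|y - x| * `|y - x| `^ g).
  apply: antiderivative_exists => // x y xc yc.
  by have := vh b b _ _ xc yc; rewrite rho_fiber.
have [u uP] := choice H; exists u.
have uv : fiber_derivative c u v by apply: (@fiber_derivativeI _ g K) => // b; have [] := uP b.
have u0 b : u b 0 = 0 by have [] := uP b.
by split=> //; apply: (holder_antider _ hv uv u0); rewrite c0.
Qed.

(** * Affine and cohomological equations over a fiber contraction *)

Section Contraction.
Variables (c L Lam k th : R) (T : B -> B) (f f' : B -> R -> R).
Hypotheses (c0 : 0 <= c) (c1 : c <= 1) (L0 : 0 <= L) (Lam1 : 1 <= Lam).
Hypotheses (k0 : 0 < k) (th0 : 0 <= th) (th1 : th < 1).
Hypothesis TL : forall b b', tau (T b) (T b') <= L * tau b b'.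
Hypothesis FLam : forall b b' x x', 0 <= x <= c -> 0 <= x' <= c ->
  rho (T b) (T b') (f b x) (f b' x') <= Lam * rho b b' x x'.
Hypothesis hf : holder c f.
Hypothesis ff' : fiber_derivative c f f'.
Hypothesis f'k : forall b x, 0 <= x <= c -> k <= f' b x <= th.
Hypothesis f0 : forall b, f b 0 = 0.

Let I0 : 0 <= (0 : R) <= c. Proof. by rewrite lexx. Qed.

Lemma contraction_lip b x y : 0 <= x <= c -> 0 <= y <= c ->
  `|f b y - f b x| <= th * `|y - x|.
Proof.
move: (k0) => ?; apply: (fiber_derivative_mean_value ff') => b' s sc; have := f'k b' sc => ?.
by rewrite ger0_norm; lra.
Qed.

Lemma contraction_bound b x : 0 <= x <= c -> 0 <= f b x <= th * x.
Proof.
move=> xc; have /andP[x0 _] := xc.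
have := fiber_derivative_increment c1 ff' f'k b I0 xc x0; rewrite f0 !subr0.
by move=> /andP[h1 h2]; rewrite h2 andbT; apply: le_trans h1; rewrite mulr_ge0// ltW.
Qed.

Lemma contraction_in b x : 0 <= x <= c -> 0 <= f b x <= c.
Proof.
move=> xc; have /andP[h1 h2] := contraction_bound b xc; have /andP[x0 xc'] := xc.
by rewrite h1 (le_trans h2)// (le_trans _ xc')// ler_piMl// ltW.
Qed.

Lemma affine_equation_holder q u a : 0 <= q < 1 ->
  (forall b x, 0 <= x <= c -> `|a b x| <= q) -> holder c u -> holder c a ->
  exists2 Z, holder c Z &
    forall b x, 0 <= x <= c -> Z b x = u b x + a b x * Z (T b) (f b x).
Proof.
move: (Lam1) => Lam1' q01 aq hu ha; have /andP[q0 q1] := q01.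
have [C C0 uC] := holder_bounded hu.
have [Z ZP] : exists Z : (B * R)%type -> R, forall p, 0 <= p.2 <= c ->
    Z p = u p.1 p.2 + a p.1 p.2 * Z (T p.1, f p.1 p.2) /\ `|Z p| <= C / (1 - q) * 1.
  apply: (@series_solution R (B * R)%type (fun p => is_true (0 <= p.2 <= c))
    (fun p => (T p.1, f p.1 p.2)) _ (fun p => u p.1 p.2) (fun p => a p.1 p.2)
    (fun=> 1)) => //=.
  - by move=> [b x] /= xc; exact: contraction_in.
  - by move=> [b x] /= xc; rewrite mulr1 uC.
  - by move=> [b x] /= xc; rewrite !mulr1 aq.
have ZE b x : 0 <= x <= c -> Z (b, x) = u b x + a b x * Z (T b, f b x).
  by move=> xc; have [] := ZP (b, x) xc.
pose D := C / (1 - q).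
have D0 : 0 <= D by rewrite divr_ge0//; lra.
have ZD b x : 0 <= x <= c -> `|Z (b, x)| <= D.
  by move=> xc; have [_] := ZP (b, x) xc; rewrite mulr1.
exists (fun b x => Z (b, x)) => //.
have hq := powR_near1 Lam1 q1.
move: hu ha hq; apply: filterS3 => g [K [g01 K0 ub uh]] [M [_ M0 ab ah]] hq.
have /andP[g0 g1] := g01.
pose eta := q * Lam `^ g.
have Lg : 1 <= Lam `^ g by apply: powR_ge1 => //; exact: ltW.
have eta0 : 0 <= eta < 1 by rewrite /eta hq andbT mulr_ge0 ?powR_ge0.
have K'0 : 0 <= (K + M * D) / (1 - eta).
  by apply: divr_ge0; [rewrite addr_ge0// mulr_ge0|case/andP: eta0; lra].
exists (D + (K + M * D) / (1 - eta)); split=> // [|b x xc|b b' x x' xc xc'].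
- by rewrite addr_ge0.
- by apply: (le_trans (ZD _ _ xc)); rewrite lerDl.
apply: (@le_trans _ _ ((K + M * D) / (1 - eta) * rho b b' x x' `^ g)); last first.
  by rewrite ler_wpM2r ?powR_ge0// lerDr.
(* The iteration runs on pairs of points under F x F: the difference of Z satisfies an inequality
   with coefficient q, and rho^g grows by at most Lam^g. *)
apply: (@iter_bound R ((B * R) * (B * R))%type
  (fun p => (0 <= p.1.2 <= c) /\ (0 <= p.2.2 <= c))
  (fun p => ((T p.1.1, f p.1.1 p.1.2), (T p.2.1, f p.2.1 p.2.2))) _
  (fun p => `|Z p.1 - Z p.2|) (fun p => rho p.1.1 p.2.1 p.1.2 p.2.2 `^ g) (fun=> 1)
  q eta (K + M * D) (2 * D) _ _ _ _ _ _ _ _ _ ((b, x), (b', x'))) => //=.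
- by move=> [[d y] [d' y']] /= [yc yc']; split; exact: contraction_in.
- by apply: addr_ge0 => //; apply: mulr_ge0.
- by rewrite mulr_ge0.
- by move=> p _; exact: powR_ge0.
- move=> [[d y] [d' y']] /= [yc yc']; apply: (le_trans (ler_normB _ _)).
  by have := ZD d _ yc; have := ZD d' _ yc'; lra.
- move=> [[d y] [d' y']] /= [yc yc']; rewrite (ZE d y)// (ZE d' y')//.
  have -> : u d y + a d y * Z (T d, f d y) - (u d' y' + a d' y' * Z (T d', f d' y')) =
    (u d y - u d' y') + (a d y - a d' y') * Z (T d', f d' y')
     + a d y * (Z (T d, f d y) - Z (T d', f d' y')) by ring.
  have h1 := uh d d' _ _ yc yc'.
  have h2 := ler_normM (ah d d' _ _ yc yc') (ZD (T d') _ (contraction_in d' yc')).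
  have h3 := ler_normM (aq d _ yc) (lexx `|Z (T d, f d y) - Z (T d', f d' y')|).
  apply: (le_trans (ler_normD _ _)); apply: lerD => //.
  by apply: (le_trans (ler_normD _ _)); lra.
- move=> [[d y] [d' y']] /= [yc yc']; rewrite /eta -mulrA ler_wpM2l//.
  rewrite -powRM ?rho_ge0//; last lra.
  by apply: powR_mono; [rewrite rho_ge0 FLam|exact: ltW].
- by move=> p _; rewrite !mulr1 /eta ler_peMr.
Qed.

(* Formally Z' = (u' + a' (Z o F)) + (a f') (Z' o F), again an affine equation;
   its solution W is proved to be Z' because the remainder e of the pair (Z, W)
   satisfies e <= O(|y - x|^(1+g)) + q (e o F). *)
Lemma affine_equation n q u a : 0 <= q < 1 ->
  (forall b x, 0 <= x <= c -> `|a b x| <= q) -> holder_class n c u -> holder_class n c a ->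
      holder_class n c f' ->
  exists2 Z, holder_class n c Z &
    forall b x, 0 <= x <= c -> Z b x = u b x + a b x * Z (T b) (f b x).
Proof.
move: (k0) (th1) (c1) => k0' th1' c1' q01; elim: n u a => [|n IH] u a aq U A F'.
  exact: (affine_equation_holder q01 aq U A).
have [Z hZ ZE] := IH _ _ aq (holder_classW U) (holder_classW A) (holder_classW F').
have af := holder_class_lipschitz c1 A; have An := holder_classW A.
move: U A => [hu [u' uu' hu']] [ha [a' aa' ha']].
have hF : holder_class n c f.
  by apply: holder_classW; split=> //; exists f' => //; exact: holder_classW F'.
have hZF : holder_class n c (fun b x => Z (T b) (f b x)).
  exact: (holder_class_comp c1 L0 TL contraction_in hZ hF).
have /andP[q0 q1] := q01.
have f'1 b x : 0 <= x <= c -> `|f' b x| <= 1.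
  by move=> xc; have := f'k b xc => ?; rewrite ger0_norm; lra.
(* The new coefficient a f' is again bounded by q, as |f'| <= 1, so the induction hypothesis applies
   with the same q. *)
have [W hW WE] : exists2 W, holder_class n c W & forall b x, 0 <= x <= c ->
    W b x = u' b x + a' b x * Z (T b) (f b x) + a b x * f' b x * W (T b) (f b x).
  apply: (IH (fun b x => u' b x + a' b x * Z (T b) (f b x)) (fun b x => a b x * f' b x)).
  - by move=> b x xc; rewrite -[q]mulr1; apply: ler_normM; [exact: aq|exact: f'1].
  - by apply: holder_class_add => //; exact: holder_class_mul.
  - by apply: holder_class_mul => //; exact: holder_classW F'.
  - exact: holder_classW.
exists Z => //; split; first exact: holder_class_holder hZ.
exists W => //.
have [D D0 ZD] := holder_bounded (holder_class_holder hZ).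
have [E E0 WEb] := holder_bounded (holder_class_holder hW).
have [Af Af0 aL] := af.
move: uu' aa' ff' (holder_class_holder hZ) => uu' aa' ff0 hZ0.
near=> g.
have [K [g01 K0 uh]] : exists K, derivative_with c g K u u' by near: g.
have [M [_ M0 ah]] : exists K, derivative_with c g K a a' by near: g.
have [N [_ N0 fh]] : exists K, derivative_with c g K f f' by near: g.
have [J [_ J0 _ Zh]] : exists K, holder_with c g K Z by near: g.
have /andP[g0 g1] := g01.
pose Q := K + M * D + Af * J + q * (E * N).
have Q0 : 0 <= Q by rewrite !(addr_ge0, mulr_ge0).
exists (Q / (1 - q)); split=> //; first by rewrite divr_ge0//; lra.
move=> b x y xc yc.
apply: (@iter_bound R (B * (R * R))%type
  (fun p => (0 <= p.2.1 <= c) /\ (0 <= p.2.2 <= c))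
  (fun p => (T p.1, (f p.1 p.2.1, f p.1 p.2.2))) _
  (fun p => `|Z p.1 p.2.2 - Z p.1 p.2.1 - W p.1 p.2.1 * (p.2.2 - p.2.1)|)
  (fun p => `|p.2.2 - p.2.1| * `|p.2.2 - p.2.1| `^ g) (fun=> 1)
  q q Q (2 * D + E) _ _ _ _ _ _ _ _ _ (b, (x, y))) => //=.
- by move=> [d [s t]] /= [sc tc]; split; exact: contraction_in.
- by apply: addr_ge0 => //; apply: mulr_ge0.
- move=> [d [s t]] /= [sc tc]; rewrite mulr1.
  apply: (le_trans (ler_normB _ _)); apply: lerD.
    apply: (le_trans (ler_normB _ _)).
    by have := ZD d _ sc; have := ZD d _ tc; lra.
  rewrite -[E]mulr1; apply: ler_normM; first exact: WEb.
  exact: (norm_sub_le1 c1 sc tc).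
- move=> [d [s t]] /= [sc tc].
  have fs := contraction_in d sc; have ft := contraction_in d tc.
  rewrite (ZE d s)// (ZE d t)// (WE d s)//.
  set Zs := Z (T d) (f d s); set Zt := Z (T d) (f d t); set Ws := W (T d) (f d s).
  have -> : u d t + a d t * Zt - (u d s + a d s * Zs) -
     (u' d s + a' d s * Zs + a d s * f' d s * Ws) * (t - s) =
     (u d t - u d s - u' d s * (t - s)) + (a d t - a d s - a' d s * (t - s)) * Zs
     + (a d t - a d s) * (Zt - Zs)
     + a d s * (Ws * (f d t - f d s - f' d s * (t - s)))
     + a d s * (Zt - Zs - Ws * (f d t - f d s)) by ring.
  set h := `|t - s| * `|t - s| `^ g.
  have h1 := uh d _ _ sc tc; rewrite -/h in h1.
  have h2 := ler_normM (ah d _ _ sc tc) (ZD (T d) _ fs); rewrite -/h -/Zs in h2.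
  (* At this point Z is only known to be Hoelder; together with the Lipschitz bound for a this gives
     exactly order 1 + g. *)
  have h3 : `|(a d t - a d s) * (Zt - Zs)| <= Af * J * h.
    have -> : Af * J * h = (Af * `|t - s|) * (J * `|t - s| `^ g) by rewrite /h; ring.
    apply: ler_normM; first exact: aL.
    apply: (le_trans (Zh _ _ _ _ ft fs)); rewrite ler_wpM2l// rho_fiber.
    apply: powR_mono; last exact: ltW.
    rewrite normr_ge0 (le_trans (contraction_lip d sc tc))// ler_piMl//; exact: ltW.
  have h4 := ler_normM (aq d _ sc) (ler_normM (WEb (T d) _ fs) (fh d _ _ sc tc)).
  rewrite -/h -/Ws in h4.
  have h5 := ler_normM (aq d _ sc) (lexx `|Zt - Zs - Ws * (f d t - f d s)|).
  apply: (le_trans (ler_normD _ _)); apply: lerD => //.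
  apply: (le_trans (ler_normD _ _)).
  apply: (le_trans (lerD (ler_normD _ _) (lexx _))).
  apply: (le_trans (lerD (lerD (ler_normD _ _) (lexx _)) (lexx _))).
  rewrite /Q; lra.
- move=> [d [s t]] /= [sc tc]; rewrite ler_wpM2l//.
  have h : `|f d t - f d s| <= `|t - s|.
    by rewrite (le_trans (contraction_lip d sc tc))// ler_piMl//; exact: ltW.
  by apply: ler_pM; rewrite ?powR_ge0//; apply: powR_mono; [rewrite normr_ge0|exact: ltW].
Unshelve. all: by end_near. Qed.

(* The coefficient of S o F is 1, so the gain comes from interpolation: psi
   varies by at most rho^gam and by at most (x + x')^gam, hence by
   rho^g (x + x')^(gam - g), which F contracts when g is small. *)
Lemma cohomological_equation_holder psi : holder c psi -> (forall b, psi b 0 = 0) ->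
  exists S, [/\ holder c S, forall b, S b 0 = 0,
    forall b x, 0 <= x <= c -> S b x = psi b x + S (T b) (f b x) &
    exists D gam, [/\ 0 <= D, 0 < gam <= 1 &
      forall b x, 0 <= x <= c -> `|S b x| <= D * x `^ gam]].
Proof.
move: (Lam1) (th0) (th1) (c0) (c1) => Lam1' th0' th1' c0' c1' hpsi psi0.
have [gam [K [gam01 K0 psib psih]]] := holder_ex hpsi; have /andP[gam0 gam1] := gam01.
have psiK b x : 0 <= x <= c -> `|psi b x| <= K * x `^ gam.
  move=> xc; have := psih b b _ _ xc I0; rewrite psi0 rho_fiber !subr0.
  by rewrite (ger0_norm (x := x))//; case/andP: xc.
have thg : 0 <= th `^ gam < 1 by rewrite powR_ge0 powR_lt1// th0.
have fg b x : 0 <= x <= c -> (f b x) `^ gam <= th `^ gam * x `^ gam.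
  move=> xc; have /andP[x0 _] := xc; rewrite -powRM//.
  by apply: powR_mono; [exact: contraction_bound|exact: ltW].
have [Z ZP] : exists Z : (B * R)%type -> R, forall p, 0 <= p.2 <= c ->
    Z p = psi p.1 p.2 + 1 * Z (T p.1, f p.1 p.2) /\
    `|Z p| <= K / (1 - th `^ gam) * p.2 `^ gam.
  (* The coefficient being 1, convergence comes from the weight x^gam, which f contracts by
     th^gam. *)
  apply: (@series_solution R (B * R)%type (fun p => is_true (0 <= p.2 <= c))
    (fun p => (T p.1, f p.1 p.2)) _ (fun p => psi p.1 p.2) (fun=> 1)
    (fun p => p.2 `^ gam)) => //=.
  - by move=> [b x] /= xc; exact: contraction_in.
  - by move=> p _; exact: powR_ge0.
  - by move=> [b x] /= xc; exact: psiK.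
  - by move=> [b x] /= xc; rewrite normr1 mul1r fg.
have ZE b x : 0 <= x <= c -> Z (b, x) = psi b x + Z (T b, f b x).
  by move=> xc; have [] := ZP (b, x) xc; rewrite mul1r.
pose D := K / (1 - th `^ gam).
have D0 : 0 <= D by rewrite divr_ge0// subr_ge0 ltW//; case/andP: thg.
have ZD b x : 0 <= x <= c -> `|Z (b, x)| <= D * x `^ gam.
  by move=> xc; have [_] := ZP (b, x) xc.
exists (fun b x => Z (b, x)); split=> //; last by exists D, gam; split.
  near=> g.
  have g0 : 0 < g by near: g; exact: nbhs_right_gt.
  have gg : g <= gam / 2 by near: g; apply: nbhs_right_le; rewrite divr_gt0.
  (* Half of the exponent gam is kept as a reserve of contraction: for g <= gam/2 the weight (x +
     x')^(gam - g) contracts at least by q, a rate fixed before g is chosen. *)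
  pose q := th `^ (gam / 2).
  have q0 : 0 <= q by exact: powR_ge0.
  have hq : q * Lam `^ g < 1.
    near: g; apply: powR_near1 => //; apply: powR_lt1; first by rewrite th0.
    by rewrite divr_gt0.
  have Lg : 1 <= Lam `^ g by apply: powR_ge1 => //; exact: ltW.
  pose eta := q * Lam `^ g.
  have eta0 : 0 <= eta < 1 by rewrite /eta hq andbT mulr_ge0 ?powR_ge0.
  have qeta : q <= eta by rewrite /eta ler_peMr.
  have th01 : 0 <= th <= 1 by rewrite th0' ltW.
  have [thq thq'] : th `^ gam <= q /\ th `^ (gam - g) <= q :=
    powR_half_exponent th01 gam0 gg.
  have E0 : 0 <= 2 * K / (1 - eta).
    by apply: divr_ge0; [rewrite mulr_ge0|case/andP: eta0; lra].
  exists (D + 2 * K / (1 - eta) * 2 `^ (gam - g)).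
  split=> [|||b b' x x' xc xc'].
  - by apply/andP; split; lra.
  - by rewrite addr_ge0// mulr_ge0 ?powR_ge0.
  - move=> b x xc; apply: (le_trans (ZD _ _ xc)); apply: ler_wpDr.
      by rewrite mulr_ge0 ?powR_ge0.
    by rewrite ler_piMr//; apply: powR_le1; lra.
  rewrite mulrDl; apply: ler_wpDl; first by rewrite mulr_ge0 ?powR_ge0.
  apply: (@le_trans _ _ (2 * K / (1 - eta) *
      (rho b b' x x' `^ g * (x + x') `^ (gam - g)))); last first.
    have h : (x + x') `^ (gam - g) <= 2 `^ (gam - g) by apply: powR_mono; lra.
    rewrite -[leRHS]mulrA ler_wpM2l// [leRHS]mulrC.
    by rewrite ler_wpM2l ?powR_ge0.
  apply: (@iter_bound R ((B * R) * (B * R))%type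
    (fun p => (0 <= p.1.2 <= c) /\ (0 <= p.2.2 <= c))
    (fun p => ((T p.1.1, f p.1.1 p.1.2), (T p.2.1, f p.2.1 p.2.2))) _
    (fun p => `|Z p.1 - Z p.2|)
    (fun p => rho p.1.1 p.2.1 p.1.2 p.2.2 `^ g * (p.1.2 + p.2.2) `^ (gam - g))
    (fun p => (p.1.2 + p.2.2) `^ gam)
    1 eta (2 * K) (2 * D) _ _ _ _ _ _ _ _ _ ((b, x), (b', x'))) => //=.
  - by move=> [[d y] [d' y']] /= [yc yc']; split; exact: contraction_in.
  - by rewrite mulr_ge0.
  - by rewrite mulr_ge0.
  - by move=> p _; rewrite mulr_ge0 ?powR_ge0.
  - move=> [[d y] [d' y']] /= [yc yc']; apply: (le_trans (ler_normB _ _)).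
    have /andP[y0 _] := yc; have /andP[y'0 _] := yc'.
    by apply: le_trans (powR_sum_le D0 gam0 y0 y'0); apply: lerD; exact: ZD.
  - move=> [[d y] [d' y']] /= [yc yc']; rewrite mul1r (ZE d y)// (ZE d' y')//.
    have /andP[y0 _] := yc; have /andP[y'0 _] := yc'.
    have -> : psi d y + Z (T d, f d y) - (psi d' y' + Z (T d', f d' y')) =
      (psi d y - psi d' y') + (Z (T d, f d y) - Z (T d', f d' y')) by ring.
    apply: (le_trans (ler_normD _ _)); rewrite lerD2r.
    set r := rho _ _ _ _; set m := y + y'.
    have r0 : 0 <= r by exact: rho_ge0.
    have m0 : 0 <= m by rewrite addr_ge0.
    apply: powR_interpolation => //; first exact: psih.
    apply: (le_trans (ler_normB _ _)).
    by apply: (le_trans (lerD (psiK _ _ yc) (psiK _ _ yc'))); exact: powR_sum_le.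
  - move=> [[d y] [d' y']] /= [yc yc']; rewrite mul1r.
    have /andP[y0 _] := yc; have /andP[y'0 _] := yc'.
    apply: (@le_trans _ _ ((Lam `^ g * rho d d' y y' `^ g) *
        (th `^ (gam - g) * (y + y') `^ (gam - g)))).
      rewrite -!powRM ?rho_ge0 ?addr_ge0//; last lra.
      apply: ler_pM; rewrite ?powR_ge0//; apply: powR_mono.
      + by rewrite rho_ge0 FLam.
      + exact: ltW.
      + have /andP[h1 h2] := contraction_bound d yc.
        have /andP[h3 h4] := contraction_bound d' yc'.
        by rewrite addr_ge0//= mulrDr lerD.
      + lra.
    have h := ler_wpM2r (mulr_ge0 (powR_ge0 Lam g) (mulr_ge0 (powR_ge0 (rho d d' y y') g)
       (powR_ge0 (y + y') (gam - g)))) thq'.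
    by rewrite /eta; lra.
  - move=> [[d y] [d' y']] /= [yc yc']; rewrite mul1r.
    have /andP[y0 _] := yc; have /andP[y'0 _] := yc'.
    apply: (@le_trans _ _ (th `^ gam * (y + y') `^ gam)).
      rewrite -powRM ?addr_ge0//; apply: powR_mono; last exact: ltW.
      have /andP[h1 h2] := contraction_bound d yc.
      have /andP[h3 h4] := contraction_bound d' yc'.
      by rewrite addr_ge0//= mulrDr lerD.
    by rewrite ler_wpM2r ?powR_ge0// (le_trans thq).
move=> b; apply/eqP; rewrite -normr_le0; apply: (le_trans (ZD b 0 I0)).
by rewrite powR0 ?mulr0// gt_eqF.
Unshelve. all: by end_near. Qed.

(** Differentiating once turns the coefficient 1 into f' <= th < 1: formally S' solves W = psi' + f'
    (W o F), which [affine_equation] solves in the right class. What remains is to identify W with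
    S'. *)
Lemma cohomological_equation n psi : holder_class n c psi -> holder_class n c f' ->
    (forall b, psi b 0 = 0) ->
  exists S, [/\ holder_class n c S, forall b, S b 0 = 0 &
    forall b x, 0 <= x <= c -> S b x = psi b x + S (T b) (f b x)].
Proof.
move=> hpsi F' psi0.
have [S [hS S0 SE [D [gam [D0 gam01 SD]]]]] :=
  cohomological_equation_holder (holder_class_holder hpsi) psi0.
exists S; split=> //; case: n hpsi F' => [|n]//= [_ [psi' dpsi hpsi']] F'.
have th01 : 0 <= th < 1 by rewrite th0.
have f'th b x : 0 <= x <= c -> `|f' b x| <= th.
  move=> xc; have /andP[h1 h2] := f'k b xc; rewrite ger0_norm//.
  by rewrite (le_trans (ltW k0)).
have hF' : holder_class n c f' by apply: holder_classW; exact: F'.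
have [W hW WE] := affine_equation th01 f'th hpsi' hF' hF'.
split=> //; exists W => //.
have [E E0 WEb] := holder_bounded (holder_class_holder hW).
have /andP[gam0 gam1] := gam01.
(* A common rate for the two weights below: |t - s|^(1+g) contracts by th <= q, and (s + t)^gam by
   q. *)
pose q := th `^ gam.
have q01 : 0 <= q < 1 by rewrite powR_ge0 powR_lt1.
have thq : th <= q by apply: powR_self => //; rewrite th0 ltW.
move: dpsi ff'; apply: filterS2 => g [K [g01 K0 ph]] [N [_ N0 fh]].
have /andP[g0 g1] := g01.
exists ((K + E * N) / (1 - q)); split=> //.
  by apply: divr_ge0; [rewrite addr_ge0// mulr_ge0|case/andP: q01; rewrite subr_ge0 => _ /ltW].
move=> b x y xc yc.
apply: (@iter_bound R (B * (R * R))%type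
  (fun p => (0 <= p.2.1 <= c) /\ (0 <= p.2.2 <= c))
  (fun p => (T p.1, (f p.1 p.2.1, f p.1 p.2.2))) _
  (fun p => `|S p.1 p.2.2 - S p.1 p.2.1 - W p.1 p.2.1 * (p.2.2 - p.2.1)|)
  (fun p => `|p.2.2 - p.2.1| * `|p.2.2 - p.2.1| `^ g) (fun p => (p.2.1 + p.2.2) `^ gam)
  1 q (K + E * N) (2 * D + E) _ _ _ _ _ _ _ _ _ (b, (x, y))) => //=.
- by move=> [d [s t]] /= [sc tc]; split; exact: contraction_in.
- by apply: addr_ge0 => //; apply: mulr_ge0.
- by apply: addr_ge0 => //; apply: mulr_ge0.
- move=> [d [s t]] /= [sc tc].
  have /andP[s0 s1] := sc; have /andP[t0 t1] := tc.
  (* The remainder of (S, W) obeys an inequality with coefficient 1, so its initial bound must be by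
     a weight that decays along orbits; a constant would not do. *)
  have st : `|t - s| <= (s + t) `^ gam.
    apply: (@le_trans _ _ (`|t - s| `^ gam)).
      by apply: powR_self => //; rewrite normr_ge0 (norm_sub_le1 c1 sc tc).
    apply: powR_mono; last exact: ltW.
    by rewrite normr_ge0 ler_norml; apply/andP; split; lra.
  have hs : `|S d s| <= D * (s + t) `^ gam.
    apply: (le_trans (SD _ _ sc)); rewrite ler_wpM2l//.
    by apply: powR_mono; [rewrite s0 lerDl|exact: ltW].
  have ht : `|S d t| <= D * (s + t) `^ gam.
    apply: (le_trans (SD _ _ tc)); rewrite ler_wpM2l//.
    by apply: powR_mono; [rewrite t0 lerDr|exact: ltW].
  have hw := ler_normM (WEb d _ sc) st.
  rewrite mulrDl; apply: (le_trans (ler_normB _ _)); apply: lerD => //.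
  by apply: (le_trans (ler_normB _ _)); apply: (le_trans (lerD ht hs)); lra.
- move=> [d [s t]] /= [sc tc]; rewrite mul1r.
  have fs := contraction_in d sc; have ft := contraction_in d tc.
  rewrite (SE d s)// (SE d t)// (WE d s)//.
  set Ss := S (T d) (f d s); set St := S (T d) (f d t); set Ws := W (T d) (f d s).
  have -> : psi d t + St - (psi d s + Ss) - (psi' d s + f' d s * Ws) * (t - s) =
     (psi d t - psi d s - psi' d s * (t - s)) + Ws * (f d t - f d s - f' d s * (t - s))
     + (St - Ss - Ws * (f d t - f d s)) by ring.
  apply: (le_trans (ler_normD _ _)); rewrite lerD2r.
  apply: (le_trans (ler_normD _ _)); rewrite mulrDl; apply: lerD; first exact: ph.
  by rewrite -mulrA; apply: ler_normM; [exact: WEb|exact: fh].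
- move=> [d [s t]] /= [sc tc]; rewrite mul1r mulrA.
  have h := contraction_lip d sc tc.
  have h' : `|f d t - f d s| <= `|t - s|.
    by rewrite (le_trans h)// ler_piMl//; exact: ltW.
  apply: ler_pM; rewrite ?powR_ge0//; first by rewrite (le_trans h)// ler_wpM2r.
  by apply: powR_mono; [rewrite normr_ge0|exact: ltW].
- move=> [d [s t]] /= [sc tc]; rewrite mul1r.
  have /andP[s0 s1] := sc; have /andP[t0 t1] := tc.
  rewrite -powRM ?addr_ge0//; apply: powR_mono; last exact: ltW.
  have /andP[h1 h2] := contraction_bound d sc.
  have /andP[h3 h4] := contraction_bound d tc.
  by rewrite addr_ge0//= mulrDr lerD.
Qed.

Lemma holder_at0 u : holder c u -> holder c (fun b _ => u b 0).
Proof.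
apply: filterS => g [K [g01 K0 ub uh]]; exists K; split=> // [b x _|b b' x x' _ _].
  exact: ub.
apply: (le_trans (uh _ _ _ _ I0 I0)); rewrite ler_wpM2l//.
apply: powR_mono; last by case/andP: g01 => /ltW.
by rewrite rho_ge0 /rho subrr normr0 addr0 lerDl /=.
Qed.

(* psi = ln (f' / f' 0) and Phi' = exp S, so that Phi is the limit of
   f^n / (product of the multipliers). *)
Lemma linearization_exists n : holder_class n c f' ->
  exists S Phi, [/\ holder_class n c S, forall b, S b 0 = 0,
    fiber_derivative c Phi (fun b x => expR (S b x)), holder c Phi & (forall b, Phi b 0 = 0) /\
    forall b x, 0 <= x <= c -> Phi (T b) (f b x) = f' b 0 * Phi b x].
Proof.
move=> F'; have f'gt0 b x : 0 <= x <= c -> 0 < f' b x.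
  by move=> xc; have /andP[h _] := f'k b xc; exact: lt_le_trans h.
have hln : holder_class n c (fun b x => ln (f' b x)).
  by apply: (holder_class_ln c1 k0 _ F') => b x xc; have /andP[] := f'k b xc.
have hpsi : holder_class n c (fun b x => ln (f' b x) + - ln (f' b 0)).
  apply: holder_class_add => //; apply: holder_class_opp => //;
      apply: (@holder_class_base _ _ (fun b => ln (f' b 0))) => //.
  exact: (holder_at0 (holder_class_holder hln)).
have [|S [hS S0 SE]] := cohomological_equation hpsi F'; first by move=> b; rewrite subrr.
have hexp := holder_class_exp c1 hS.
have c01 : 0 <= c <= 1 by rewrite c0.
have [Phi [dPhi hPhi Phi0]] := antider_exists c01 (holder_class_holder hexp).
exists S, Phi; split=> //; split=> // b x xc.
(* Exponentiating the equation of S gives exp(S o F) f' = lam_b exp S. So both sides of Phi o F =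
   lam_b Phi have the same fiber derivative, and both vanish at 0. *)
have d1 : fiber_derivative c (fun b x => Phi (T b) (f b x)) (fun b x => f' b 0 * expR (S b x)).
  apply: (@fiber_derivative_ext _ (fun b x => Phi (T b) (f b x)) _
      (fun b x => expR (S (T b) (f b x)) * f' b x)) => //.
    move=> d s sc; rewrite (SE d s)// expRD expRD expRN !lnK ?posrE ?f'gt0//.
    by field; rewrite gt_eqF// f'gt0.
  apply: fiber_derivative_comp dPhi ff' => //;
      first exact: holder_bounded (holder_class_holder hexp).
    by exists th => // d s t; exact: contraction_lip.
  exact: contraction_in.
have d2 : fiber_derivative c (fun b x => f' b 0 * Phi b x) (fun b x => f' b 0 * expR (S b x)).
  have hc : fiber_derivative c (fun b (_ : R) => f' b 0) (fun _ _ => 0).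
    apply: (@fiber_derivativeI _ 1 0) => // d s t _ _.
    by rewrite subrr mul0r subr0 normr0 mul0r.
  apply: (@fiber_derivative_ext _ (fun b x => f' b 0 * Phi b x) _
     (fun b x => 0 * Phi b x + f' b 0 * expR (S b x))) => //.
    by move=> d s _; rewrite mul0r add0r.
  apply: fiber_derivative_mul => //.
  - exact: holder_bounded (holder_at0 (holder_class_holder F')).
  - exact: holder_bounded hPhi.
  - exact: holder_bounded (holder_cst _ _).
  - exact: (fiber_derivative_lipschitz c1 (holder_bounded (holder_class_holder hexp)) dPhi).
apply: (fiber_derivative_unique d1 d2) => //.
by move=> d; rewrite f0 !Phi0 mulr0.
Qed.

End Contraction.

(** * Fiber expansions *)

Section Expansion.
Variables (c L k M : R) (T : B -> B) (f f' : B -> R -> R).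
Hypotheses (c0 : 0 < c) (c1 : c <= 1) (L0 : 0 <= L) (k1 : 1 < k).
Hypothesis fL : forall b b' x x', 0 <= x <= c -> 0 <= x' <= c ->
  `|f b x - f b' x'| <= L * rho b b' x x'.
Hypothesis hf : holder c f.
Hypothesis ff' : fiber_derivative c f f'.
Hypothesis f'k : forall b x, 0 <= x <= c -> k <= f' b x <= M.
Hypothesis f0 : forall b, f b 0 = 0.

Let k0 : 0 < k. Proof. by rewrite (lt_trans _ k1). Qed.
Let I0 : 0 <= (0 : R) <= c. Proof. by rewrite lexx ltW. Qed.

Lemma expansion_ge b x y : 0 <= x <= c -> 0 <= y <= c ->
  k * `|y - x| <= `|f b y - f b x|.
Proof.
move=> xc yc; wlog xy : x y xc yc / x <= y => [hw|].
  have [xy|/ltW yx] := leP x y; first exact: hw.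
  by rewrite distrC (distrC (f b y)); exact: hw.
have /andP[h _] := fiber_derivative_increment c1 ff' f'k b xc yc xy.
by rewrite (ger0_norm (x := y - x)) ?subr_ge0// (le_trans h)// ler_norm.
Qed.

Lemma expansion_inverse : exists G : B -> R -> R,
  forall b y, 0 <= y <= c -> 0 <= G b y <= c /\ f b (G b y) = y.
Proof.
have H (p : B * R) : exists x, 0 <= p.2 <= c -> 0 <= x <= c /\ f p.1 x = p.2.
  case: p => b y /=; have [yc|] := boolP (0 <= y <= c); last by exists 0.
  have cc : 0 <= c <= c by rewrite lexx ltW.
  (* An expansion fixing 0 maps [0, c] over itself, so the inverse branch is defined on all of
     [0, c]. *)
  have fc : c <= f b c.
    have /andP[h _] := fiber_derivative_increment c1 ff' f'k b I0 cc (ltW c0).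
    rewrite f0 !subr0 in h; apply: le_trans h.
    by rewrite ler_peMl ?ltW.
  have fcont : {within `[0, c], continuous (f b)}.
    apply: (@holder_within_continuous _ _ _ L 1) => // s t.
    rewrite /= !in_itv /= => sc tc; apply: (le_trans (fL _ _ sc tc)).
    by rewrite rho_fiber powRr1.
  have [|x xc fx] := @IVT R (f b) 0 c y (ltW c0) fcont.
    have /andP[y0 yc'] := yc; rewrite f0 ge_min y0 /=.
    by rewrite le_max (le_trans yc' fc) orbT.
  by exists x => _; move: xc; rewrite in_itv.
have [G GP] := choice H; exists (fun b y => G (b, y)) => b y yc.
exact: (GP (b, y)).
Qed.

(* The inverse skew product is contracting. *)
Lemma expansion_linearization n (T' : B -> B) : cancel T T' ->
  (forall b b', tau (T' b) (T' b') <= L * tau b b') -> holder_class n c f' ->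
  exists S Phi, [/\ holder_class n c S, forall b, S b 0 = 0,
    fiber_derivative c Phi (fun b x => expR (S b x)), holder c Phi & (forall b, Phi b 0 = 0) /\
    forall b x, 0 <= x <= c -> 0 <= f b x <= c -> Phi (T b) (f b x) = f' b 0 * Phi b x].
Proof.
move=> TK T'L F'; have [G GP] := expansion_inverse.
have Gc b y : 0 <= y <= c -> 0 <= G b y <= c by move=> /(GP b)[].
have fG b y : 0 <= y <= c -> f b (G b y) = y by move=> /(GP b)[].
have f'ge b x : 0 <= x <= c -> k <= f' b x by move=> /(f'k b)/andP[].
have dG := fiber_derivative_inverse c1 k0 expansion_ge Gc fG f'ge ff'.
have hG := holder_inverse c1 k0 expansion_ge Gc fG hf.
have hG' := holder_class_inverse c1 c1 k0 expansion_ge Gc fG f'ge hf ff' F'.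
have G_lip := inverse_lip k0 expansion_ge Gc fG.
have k'1 : k^-1 < 1 by rewrite invf_lt1.
have k'0 : 0 <= k^-1 by rewrite invr_ge0 ltW.
have fK b x : 0 <= x <= c -> 0 <= f b x <= c -> G b (f b x) = x.
  move=> xc fc; have := expansion_ge b xc (Gc b _ fc); rewrite fG// subrr normr0.
  by rewrite pmulr_rle0// normr_le0 subr_eq0 => /eqP.
have G0 b : G b 0 = 0 by rewrite -{1}(f0 b) fK// f0.
(* The inverse of (b, x) -> (T b, f b x) acts on the fiber over b by the inverse of f at T' b. *)
pose g b y := G (T' b) y; pose g' b y := (f' (T' b) (G (T' b) y))^-1.
have idc b x : 0 <= x <= c -> 0 <= (fun (_ : B) x => x) b x <= c by [].
have hg : holder c g := holder_comp L0 T'L idc hG (holder_id c1).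
have hg' : holder_class n c g' := holder_class_comp c1 L0 T'L idc hG' (holder_class_id n c1).
have dg : fiber_derivative c g g'.
  apply: (@fiber_derivative_ext _ g _ (fun b x => g' b x * 1)) => //.
    by move=> b x _; rewrite mulr1.
  apply: (@fiber_derivative_comp c c T' G (fun b y => (f' b (G b y))^-1) (fun _ x => x)
    (fun _ _ => 1)) => //.
  - exact: holder_bounded (holder_class_holder hG').
  - by exists 1 => // b x y _ _; rewrite mul1r.
  - exact: fiber_derivative_id.
(* k + |M| bounds f' from above and is visibly positive. *)
have g'k b y : 0 <= y <= c -> (k + `|M|)^-1 <= g' b y <= k^-1.
  move=> yc; have /andP[h1 h2] := f'k (T' b) (Gc (T' b) _ yc).
  have f'gt0 := lt_le_trans k0 h1.
  rewrite /g' !lef_pV2 ?posrE ?ltr_wpDr// h1 andbT (le_trans h2)//.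
  by rewrite (le_trans (ler_norm _))// lerDr ltW.
have gLam b b' x x' : 0 <= x <= c -> 0 <= x' <= c ->
    rho (T' b) (T' b') (g b x) (g b' x') <= (1 + L + L * L) * rho b b' x x'.
  move=> xc xc'; rewrite /rho /g.
  have h1 := T'L b b'.
  have h2 : `|G (T' b) x - G (T' b') x'| <= `|x - x'| + L * (L * tau b b').
    have e1 := expansion_ge (T' b) (Gc (T' b') _ xc') (Gc (T' b) _ xc).
    rewrite (fG _ _ xc) in e1.
    have e2 := fL (T' b) (T' b') (Gc (T' b') _ xc') (Gc (T' b') _ xc').
    rewrite (fG _ _ xc') /rho subrr normr0 addr0 distrC in e2.
    apply: (@le_trans _ _ (k * `|G (T' b) x - G (T' b') x'|)).
      by rewrite ler_peMl// ltW.
    apply: (le_trans e1).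
    have -> : x - f (T' b) (G (T' b') x') = (x - x') + (x' - f (T' b) (G (T' b') x')) by ring.
    apply: (le_trans (ler_normD _ _)); rewrite lerD2l (le_trans e2)// ler_wpM2l//.
  have n0 := normr_ge0 (x - x'); have t0 := tau_ge0 b b'.
  have m1 := mulr_ge0 L0 n0; have m2 := mulr_ge0 L0 m1; have m3 := mulr_ge0 L0 t0.
  lra.
have Lam1 : 1 <= 1 + L + L * L by have := mulr_ge0 L0 L0; move: (L0); lra.
have kM0 : 0 < (k + `|M|)^-1 by rewrite invr_gt0 ltr_wpDr.
have g0 b : g b 0 = 0 by exact: G0.
have [S [Phi [hS S0 dPhi hPhi [Phi0 PhiE]]]] := linearization_exists
  (ltW c0) c1 L0 Lam1 kM0 k'0 k'1 T'L gLam hg dg g'k g0 hg'.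
exists S, Phi; split=> //; split=> // b x xc fc.
(* At the image point, the linearization of the inverse reads Phi b x = (f' b 0)^-1 Phi (T b) (f b
   x): the same coordinate linearizes both maps. *)
have := PhiE (T b) _ fc; rewrite /g /g' TK fK// G0 => ->.
by rewrite mulrA divff ?mul1r// gt_eqF// (lt_le_trans k0)// f'ge.
Qed.
End Expansion.

(** H inverts the linearizing coordinate Phi on fibers, so the conjugacy follows from injectivity of
    Phi on [0, c]. Phi is returned too, since it gives the continuous inverse of H. *)
Lemma fiber_linearization n c L k M (T : B -> B) (f f' : B -> R -> R) :
  0 < c -> c <= 1 -> 0 <= L -> 0 < k ->
  (forall b b', tau (T b) (T b') <= L * tau b b') ->
  (forall b b' x x', 0 <= x <= c -> 0 <= x' <= c ->
    `|f b x - f b' x'| <= L * rho b b' x x') ->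
  holder c f -> fiber_derivative c f f' -> holder_class n c f' ->
  (forall b x, 0 <= x <= c -> k <= f' b x <= M) -> (forall b, f b 0 = 0) ->
  M < 1 \/ 1 < k /\ (exists2 T' : B -> B, cancel T T' &
    forall b b', tau (T' b) (T' b') <= L * tau b b') ->
  exists eps H H', [/\ 0 < eps <= c,
    [/\ holder eps H, fiber_derivative eps H H' & holder_class n eps H'],
    (forall b, H b 0 = 0 /\ H' b 0 = 1),
    (forall b x, 0 <= x <= eps -> 0 <= f' b 0 * x <= eps ->
      f b (H b x) = H (T b) (f' b 0 * x)) &
    exists2 Phi, holder c Phi & forall b x, 0 <= x <= eps ->
      0 <= H b x <= c /\ Phi b (H b x) = x].
Proof.
move=> c0 c1 L0 k0 TL fL hf ff' F' f'k f0 cases.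
have I0 : 0 <= (0 : R) <= c by rewrite lexx ltW.
have [S [Phi [hS S0 dPhi hPhi [Phi0 PhiE]]]] : exists S Phi, [/\ holder_class n c S, forall b,
    S b 0 = 0,
    fiber_derivative c Phi (fun b x => expR (S b x)), holder c Phi & (forall b, Phi b 0 = 0) /\
    forall b x, 0 <= x <= c -> 0 <= f b x <= c -> Phi (T b) (f b x) = f' b 0 * Phi b x].
  case: cases => [M1|[k1 [T' TK T'L]]]; last first.
    exact: (expansion_linearization c0 c1 L0 k1 fL hf ff' f'k f0 TK T'L F').
  have Lam1 : 1 <= 1 + 2 * L by lra.
  (* The contraction results want a rate th >= 0. If M < 0, the bounds 0 < k <= f' <= M leave B
     empty and any S and Phi will do. *)
  have [M0|M0] := ltP M 0.
    exists (fun _ _ => 0), (fun _ x => x).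
    have absurd (b : B) : False by have := f'k b 0 I0; lra.
    split; [exact: holder_class_cst|by []| |exact: holder_id|split=> // b; by case: (absurd b)].
    by apply: (fiber_derivative_ext _ _ (fiber_derivative_id c1)) => b; case: (absurd b).
  have fLam b b' x x' : 0 <= x <= c -> 0 <= x' <= c ->
      rho (T b) (T b') (f b x) (f b' x') <= (1 + 2 * L) * rho b b' x x'.
    move=> xc xc'; have h1 := TL b b'; have h2 := fL b b' _ _ xc xc'.
    have r0 := rho_ge0 b b' x x'.
    have h3 : L * tau b b' <= L * rho b b' x x' by rewrite ler_wpM2l// /rho lerDl.
    rewrite {1}/rho; lra.
  have [S [Phi [hS S0 dPhi hPhi [Phi0 PhiE]]]] := linearization_exists
    (ltW c0) c1 L0 Lam1 k0 M0 M1 TL fLam hf ff' f'k f0 F'.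
  by exists S, Phi; split=> //; split=> // b x xc _; exact: PhiE.
have [K K0 SK] := holder_bounded (holder_class_holder hS).
pose kap := expR (- K); have kap0 : 0 < kap by exact: expR_gt0.
have expS b x : 0 <= x <= c -> kap <= expR (S b x) <= expR K.
  by move=> /(SK b); rewrite ler_norml !ler_expR.
have Phi_inc b x y := @fiber_derivative_increment c kap _ _ _ c1 dPhi expS b x y.
have Phi_ge b x y : 0 <= x <= c -> 0 <= y <= c ->
    kap * `|y - x| <= `|Phi b y - Phi b x|.
  move=> xc yc; wlog xy : x y xc yc / x <= y => [hw|].
    have [xy|/ltW yx] := leP x y; first exact: hw.
    by rewrite distrC (distrC (Phi b y)); exact: hw.
  have /andP[h _] := Phi_inc b _ _ xc yc xy.
  by rewrite (ger0_norm (x := y - x)) ?subr_ge0// (le_trans h)// ler_norm.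
pose M' := 1 + `|M|.
have M'1 : 1 <= M' by rewrite /M' lerDl.
have MM' : M <= M' by rewrite /M' (le_trans (ler_norm M))// lerDr.
have kap1 : kap <= 1 by rewrite /kap -expR0 ler_expR oppr_le0.
(* Phi b grows at rate at least kap, so [0, eps] lies in the image of [0, c/M']; and f b maps
   [0, c/M'] into [0, c], as its slope is at most M'. Thus f b (H b x) stays where Phi is defined,
   in the expanding case too. *)
pose eps := kap * (c / M').
have cM : 0 < c / M' <= c.
  by rewrite divr_gt0//= ?ler_pdivrMr ?ler_peMr// ?ltW// (lt_le_trans _ M'1).
have /andP[cM0 cM1] := cM.
have eps0 : 0 < eps by rewrite mulr_gt0.
have epsc : eps <= c / M' by rewrite /eps ler_piMl// ltW.
have HP (p : B * R) : exists x, 0 <= p.2 <= eps -> 0 <= x <= c / M' /\ Phi p.1 x = p.2.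
  case: p => b y /=; have [ye|] := boolP (0 <= y <= eps); last by exists 0.
  have cc : 0 <= c / M' <= c by rewrite ltW.
  have PhiC : {within `[0, c / M'], continuous (Phi b)}.
    apply: (@holder_within_continuous _ _ _ (expR K) 1) => // s t.
    rewrite /= !in_itv /= => sc tc; rewrite powRr1//.
    have expS' d z : 0 <= z <= c -> `|expR (S d z)| <= expR K.
      by move=> /(expS d)/andP[_]; rewrite ger0_norm ?expR_ge0.
    apply: (fiber_derivative_mean_value dPhi expS').
      by have /andP[t0 /le_trans ->] := tc; rewrite ?t0.
    by have /andP[t0 /le_trans ->] := sc; rewrite ?t0.
  have /andP[PhiM _] := Phi_inc b _ _ I0 cc (ltW cM0).
  rewrite Phi0 !subr0 in PhiM.
  have [|x xc fx] := @IVT R (Phi b) 0 (c / M') y (ltW cM0) PhiC.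
    have /andP[y0 ye'] := ye; rewrite Phi0 ge_min y0 /=.
    by rewrite le_max (le_trans ye' PhiM) orbT.
  by exists x => _; move: xc; rewrite in_itv.
have [H' HP'] := choice HP; pose H b x := H' (b, x).
have Hc' b x : 0 <= x <= eps -> 0 <= H b x <= c / M' by move=> xe; have [] := HP' (b, x) xe.
have Hc b x : 0 <= x <= eps -> 0 <= H b x <= c.
  by move=> /(Hc' b)/andP[-> /le_trans ->].
have PhiH b x : 0 <= x <= eps -> Phi b (H b x) = x by move=> xe; have [] := HP' (b, x) xe.
have Phi_inj b x y : 0 <= x <= c -> 0 <= y <= c -> Phi b x = Phi b y -> x = y.
  move=> xc yc E; have := Phi_ge b _ _ xc yc; rewrite E subrr normr0.
  by rewrite pmulr_rle0// normr_le0 subr_eq0 => /eqP.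
have eps1 : eps <= 1 by rewrite (le_trans epsc)// (le_trans cM1).
have E0 : 0 <= (0 : R) <= eps by rewrite lexx ltW.
have H0 b : H b 0 = 0 by apply: (Phi_inj b) => //; [exact: Hc|rewrite PhiH// Phi0].
have kS b x : 0 <= x <= c -> kap <= expR (S b x) by move=> /(expS b)/andP[].
exists eps, H, (fun b y => (expR (S b (H b y)))^-1); split.
- by rewrite eps0 (le_trans epsc).
- split.
  + exact: (holder_inverse c1 kap0 Phi_ge Hc PhiH hPhi).
  + exact: (fiber_derivative_inverse eps1 kap0 Phi_ge Hc PhiH kS dPhi).
  + exact: (holder_class_inverse c1 eps1 kap0 Phi_ge Hc PhiH kS hPhi dPhi (holder_class_exp c1 hS)).
- by move=> b; rewrite H0 S0 expR0 invr1.
- move=> b x xe le.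
  have f_in : 0 <= f b (H b x) <= c.
    have /andP[h0 hM] := Hc' b _ xe; have hc := Hc b _ xe.
    have /andP[] := fiber_derivative_increment c1 ff' f'k b I0 hc h0.
    rewrite f0 !subr0 => i1 i2; apply/andP; split.
      by apply: le_trans i1; rewrite mulr_ge0// ltW.
    apply: (le_trans i2); apply: (@le_trans _ _ (M' * (c / M'))).
      by apply: (@le_trans _ _ (M' * H b x));
          [exact: ler_wpM2r|rewrite ler_wpM2l// (le_trans _ M'1)].
    by rewrite mulrC divfK// gt_eqF// (lt_le_trans _ M'1).
  apply: (Phi_inj (T b)) => //; first exact: Hc.
  by rewrite PhiE ?Hc// !PhiH.
by exists Phi => // b x xe; split; [exact: Hc|exact: PhiH].
Qed.

(** * Hoelder classes as sequences of successive derivatives *)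

Lemma holder_class_of_family n c (D : nat -> B -> R -> R) :
  (forall i, (i <= n)%N -> holder c (D i)) ->
  (forall i, (i < n)%N -> fiber_derivative c (D i) (D i.+1)) -> holder_class n c (D 0%N).
Proof.
elim: n D => [|n IH] D hD dD; first exact: hD.
split; first exact: hD.
exists (D 1%N); first exact: dD.
by apply: (IH (fun i => D i.+1)) => i ni; [exact: hD|exact: dD].
Qed.

Lemma holder_class_family n c u : holder_class n c u -> exists D : nat -> B -> R -> R,
  [/\ D 0%N = u, forall i, (i <= n)%N -> holder c (D i) &
    forall i, (i < n)%N -> fiber_derivative c (D i) (D i.+1)].
Proof.
elim: n u => [|n IH] u /=.
  by move=> hu; exists (fun=> u); split=> // i; rewrite leqn0 => /eqP ->.
move=> [hu [v uv /IH[D [D0 hD dD]]]].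
exists (fun i => if i is i'.+1 then D i' else u); split=> // [[|i]|[|i]] //.
- exact: hD.
- by rewrite D0.
- exact: dD.
Qed.

Lemma holder_uniform n c (D : nat -> B -> R -> R) :
  (forall i, (i <= n)%N -> holder c (D i)) ->
  exists g K, forall i, (i <= n)%N -> holder_with c g K (D i).
Proof.
move=> hD; suff : \forall g \near 0^'+, exists K, forall i, (i <= n)%N -> holder_with c g K (D i).
  by move=> h; apply: (@filter_ex _ (0^'+ : set_system R) _ _ h).
elim: n hD => [|n IH] hD.
  apply: filterS (hD 0%N isT) => g [K hK]; exists K => i.
  by rewrite leqn0 => /eqP ->.
have h1 := IH (fun i ni => hD i (leqW ni)).
move: h1 (hD n.+1 (leqnn _)); apply: filterS2 => g [K hK] [M hM]; exists (K + M) => i.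
have [_ K0 _ _] := hK 0%N isT; have [_ M0 _ _] := hM.
have mono N v : 0 <= N -> N <= K + M -> holder_with c g N v -> holder_with c g (K + M) v.
  move=> N0 NKM [g01 _ vb vh]; split=> //; first by rewrite addr_ge0.
    by move=> b x xc; apply: (le_trans (vb _ _ xc)).
  by move=> b b' x x' xc xc'; apply: (le_trans (vh _ _ _ _ xc xc')); rewrite ler_wpM2r// powR_ge0.
rewrite leq_eqVlt => /predU1P[->|]; first by apply: (mono M) => //; rewrite lerDr.
by rewrite ltnS => /hK; apply: mono => //; rewrite lerDl.
Qed.

End Holder.

(** * The torus *)

Section TorusDist.
Variables (R : realType) (d : nat).
Implicit Types (v w : 'cV[R]_d) (b : torus R d).

Lemma euclid_norm_ge0 v : 0 <= euclid_norm v.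
Proof. exact: sqrtr_ge0. Qed.

Lemma sum_sqr_ge0 v : 0 <= \sum_i v i ord0 ^+ 2.
Proof. by apply: sumr_ge0 => i _; exact: sqr_ge0. Qed.

Lemma euclid_norm_sqr v : euclid_norm v ^+ 2 = \sum_i v i ord0 ^+ 2.
Proof. by rewrite sqr_sqrtr// sum_sqr_ge0. Qed.

Lemma euclid_norm_Cauchy_Schwarz v w :
  \sum_i v i ord0 * w i ord0 <= euclid_norm v * euclid_norm w.
Proof.
set s := \sum_i _; set p := euclid_norm v; set q := euclid_norm w.
have p0 : 0 <= p by exact: euclid_norm_ge0.
have q0 : 0 <= q by exact: euclid_norm_ge0.
(* Expansion of the sum of (t v_i - u w_i)^2. The weights t = q, u = p give the claim; if a norm
   vanishes, other weights show that s > 0 is impossible. *)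
have H t u : 2 * (t * u) * s <= t ^+ 2 * p ^+ 2 + u ^+ 2 * q ^+ 2.
  rewrite !euclid_norm_sqr /s !mulr_sumr -big_split /=; apply: ler_sum => i _.
  by have := sqr_ge0 (t * v i ord0 - u * w i ord0); lra.
have [p00|pn] := eqVneq p 0.
  rewrite p00 mul0r leNgt; apply/negP => s0.
  have := H (q ^+ 2 / s) 1; rewrite p00 expr0n /= mulr0 add0r expr1n mul1r mulr1.
  rewrite -mulrA divfK ?gt_eqF// => h.
  have q2 : 0 <= q ^+ 2 by exact: sqr_ge0.
  have q20 : q ^+ 2 = 0 by lra.
  by have := H 1 1; rewrite p00 q20 expr0n /= !mulr0 !mulr1; lra.
have [q00|qn] := eqVneq q 0.
  rewrite q00 mulr0 leNgt; apply/negP => s0.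
  have := H 1 (p ^+ 2 / s); rewrite q00 expr0n /= mulr0 addr0 expr1n mul1r mul1r.
  rewrite -mulrA divfK ?gt_eqF// => h.
  have p2 : 0 <= p ^+ 2 by exact: sqr_ge0.
  have p20 : p ^+ 2 = 0 by lra.
  by have := H 1 1; rewrite q00 p20 expr0n /= !mulr0 !mulr1; lra.
have pq0 : 0 < p * q by rewrite mulr_gt0// lt_neqAle eq_sym ?pn ?qn.
have h : 2 * (p * q) * s <= 2 * (p * q) * (p * q) by have := H q p; lra.
have t0 : 0 < 2 * (p * q) by lra.
by move: h; rewrite (ler_pM2l t0).
Qed.

Lemma euclid_normD v w : euclid_norm (v + w) <= euclid_norm v + euclid_norm w.
Proof.
have h0 := euclid_norm_ge0.
rewrite -(@ler_pXn2r _ 2)// ?nnegrE ?addr_ge0//.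
have := euclid_norm_Cauchy_Schwarz v w; rewrite sqrrD !euclid_norm_sqr => cs.
have -> : \sum_i (v + w) i ord0 ^+ 2 =
  \sum_i v i ord0 ^+ 2 + (\sum_i v i ord0 * w i ord0) *+ 2 + \sum_i w i ord0 ^+ 2.
  rewrite -sumrMnl -!big_split /=; apply: eq_bigr => i _.
  by rewrite mxE sqrrD.
lra.
Qed.

Lemma euclid_normN v : euclid_norm (- v) = euclid_norm v.
Proof. by congr Num.sqrt; apply: eq_bigr => i _; rewrite mxE sqrrN. Qed.

Lemma euclid_norm_le_sum v : euclid_norm v <= \sum_i `|v i ord0|.
Proof.
rewrite /euclid_norm -[leRHS]ger0_norm ?sumr_ge0// -sqrtr_sqr.
apply: ler_wsqrtr; rewrite expr2 big_distrl /=; apply: ler_sum => i _.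
rewrite -real_normK ?num_real// expr2 ler_wpM2l//.
by rewrite (bigD1 i)//= lerDl sumr_ge0.
Qed.

Lemma coord_le_euclid_norm v i : `|v i ord0| <= euclid_norm v.
Proof.
rewrite -sqrtr_sqr; apply: ler_wsqrtr; rewrite (bigD1 i)//= lerDl.
by apply: sumr_ge0 => j _; exact: sqr_ge0.
Qed.

Lemma mulmx_lip (A : 'M[R]_d) : exists2 L, 0 <= L &
  forall v, euclid_norm (A *m v) <= L * euclid_norm v.
Proof.
exists (\sum_i \sum_j `|A i j|); first by do 2 (apply: sumr_ge0 => ? _).
move=> v; apply: (le_trans (euclid_norm_le_sum _)); rewrite mulr_suml.
apply: ler_sum => i _; rewrite mxE; apply: (le_trans (ler_norm_sum _ _ _)).
rewrite mulr_suml; apply: ler_sum => j _; rewrite normrM ler_wpM2l//.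
exact: coord_le_euclid_norm.
Qed.

Definition torus_pi v : torus R d := \pi_(torus R d)%qT v.

Lemma torus_piK b : exists v, torus_pi v = b.
Proof. by exists (repr b); exact: reprK. Qed.

Lemma torus_dist_le v w : torus_dist (torus_pi v) (torus_pi w) <= euclid_norm (v - w).
Proof.
apply: ge_inf; last by exists v, w.
by exists 0 => r [v' [w' [_ _ ->]]]; exact: euclid_norm_ge0.
Qed.

Lemma torus_dist_approx b b' e : 0 < e -> exists v w,
  [/\ torus_pi v = b, torus_pi w = b' & euclid_norm (v - w) < torus_dist b b' + e].
Proof.
move=> e0; have [v vb] := torus_piK b; have [w wb] := torus_piK b'.
have [|r [v' [w' [v'b w'b ->]]] h] := @inf_adherent R [set r | exists v w,
    [/\ torus_pi v = b, torus_pi w = b' & r = euclid_norm (v - w)]] e e0.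
  split; first by exists (euclid_norm (v - w)), v, w.
  by exists 0 => r [v' [w' [_ _ ->]]]; exact: euclid_norm_ge0.
by exists v', w'.
Qed.

Lemma torus_dist_ge0 b b' : 0 <= torus_dist b b'.
Proof.
rewrite leNgt; apply/negP => h.
have [|v [w [_ _ h']]] := @torus_dist_approx b b' (- torus_dist b b'); first by rewrite oppr_gt0.
by rewrite subrr in h'; have := euclid_norm_ge0 (v - w); rewrite leNgt h'.
Qed.

Lemma torus_dist_refl b : torus_dist b b = 0.
Proof.
apply/eqP; rewrite eq_le torus_dist_ge0 andbT; have [v <-] := torus_piK b.
apply: (le_trans (torus_dist_le v v)); rewrite subrr /euclid_norm big1 ?sqrtr0//.
by move=> i _; rewrite mxE expr0n.
Qed.

Lemma torus_pi_eq v w : torus_pi v = torus_pi w <-> v - w \is a mxOver Num.int.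
Proof. by split=> [/(@eqmodP _ (@torus_equiv R d))|h]//; apply/(@eqmodP _ (@torus_equiv R d)). Qed.

Lemma torus_dist_triangle b b' b'' : torus_dist b b'' <= torus_dist b b' + torus_dist b' b''.
Proof.
apply/ler_addgt0Pl => e e0; have e2 : 0 < e / 2 by rewrite divr_gt0.
have [v [w [vb wb h1]]] := torus_dist_approx b b' e2.
have [w' [u [w'b ub h2]]] := torus_dist_approx b' b'' e2.
(* The two lifts w and w' of b' differ by an integer vector; translating u by it makes the two
   segments join. *)
have ub' : torus_pi (u + (w - w')) = b''.
  rewrite -ub; apply/torus_pi_eq; rewrite addrAC subrr add0r.
  by apply/torus_pi_eq; rewrite wb w'b.
rewrite -[in leLHS]vb -[in leLHS]ub'; apply: (le_trans (torus_dist_le _ _)).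
have -> : v - (u + (w - w')) = (v - w) + (w' - u).
  by apply/matrixP => i j; rewrite !mxE; ring.
apply: (le_trans (euclid_normD _ _)).
lra.
Qed.

Lemma torus_dist_sym b b' : torus_dist b b' = torus_dist b' b.
Proof.
congr inf; apply/seteqP; split=> r [v [w [vb wb ->]]];
  by exists w, v; split=> //; rewrite -euclid_normN opprB.
Qed.

Lemma torus_map_lip (A : 'M[int]_d) : exists2 L, 0 <= L &
  forall b b', torus_dist (torus_map A b) (torus_map A b') <= L * torus_dist b b'.
Proof.
have [L L0 hL] := mulmx_lip (map_mx intr A); exists L => // b b'.
have h e : 0 < e -> torus_dist (torus_map A b) (torus_map A b') <= L * (torus_dist b b' + e).
  move=> e0; have [v [w [vb wb h]]] := torus_dist_approx b b' e0.
  rewrite -{1}vb -{1}wb !torus_mapE; apply: (le_trans (torus_dist_le _ _)).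
  rewrite -mulmxBr; apply: (le_trans (hL _)).
  by rewrite ler_wpM2l// ltW.
apply/ler_addgt0Pl => e e0; have L1 : 0 < L + 1 by lra.
apply: (le_trans (h (e / (L + 1)) _)); first by rewrite divr_gt0.
rewrite mulrDr addrC lerD2r mulrCA ler_piMr ?ltW//.
by rewrite ltr_pdivrMr//; lra.
Qed.

Lemma torus_map_invmx (A : 'M[int]_d) : A \in unitmx ->
  cancel (@torus_map R d A) (torus_map (invmx A)).
Proof.
move=> Au b; have [v <-] := torus_piK b.
by rewrite !torus_mapE mulmxA -map_mxM mulVmx// map_mx1 mul1mx; exact: reprK.
Qed.

Lemma torus_ball_nbhs b r : 0 < r -> nbhs b [set b' | torus_dist b b' < r].
Proof.
move=> r0; rewrite nbhsE; exists [set b' | torus_dist b b' < r]; last by [].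
split; last by rewrite /= torus_dist_refl.
suff : open (torus_pi @^-1` [set b' | torus_dist b b' < r]) by [].
rewrite openE => w /= wr.
(* Balls of matrices are sup-norm balls, and the Euclidean norm is at most the sum of d coordinates.
   The divisor d + 1 makes the bound strict and is nonzero for d = 0. *)
pose s := (r - torus_dist b (torus_pi w)) / (d.+1)%:R.
have s0 : 0 < s by rewrite divr_gt0// subr_gt0.
apply/nbhs_ballP; exists s => //= w' ww'.
apply: (le_lt_trans (torus_dist_triangle _ (torus_pi w) _)).
rewrite -ltrBrDl; apply: (le_lt_trans (torus_dist_le _ _)).
apply: (le_lt_trans (euclid_norm_le_sum _)).
apply: (@le_lt_trans _ _ (d%:R * s)).
  rewrite -[d in d%:R]card_ord -sum1_card natr_sum mulr_suml.
  apply: ler_sum => i _; rewrite mul1r; apply: ltW.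
  by case: ww' => _ /(_ i ord0); rewrite /ball /= !mxE.
rewrite /s mulrCA -[ltRHS]mulr1 ltr_pM2l ?subr_gt0//.
by rewrite ltr_pdivrMr// mul1r ltr_nat.
Qed.
End TorusDist.

(** If mu <= 1, hyperbolicity puts every eigenvalue strictly inside the unit circle, so their
    product, which is the determinant up to sign, has modulus below 1; but an invertible integer
    matrix has determinant 1 or -1. *)
Lemma largest_eigenvalue_modulus_gt1 (R : realType) (d : nat) (A : 'M[int]_d) (mu : R) :
  hyperbolic_automorphism R A -> largest_eigenvalue_modulus A mu -> 1 < mu.
Proof.
move=> [Au hyp] [[z0 [z0e z0mu]] mu_max]; rewrite ltNge; apply/negP => mu1.
pose C := (R[i])%C; pose Ac : 'M[R[i]]_d := map_mx intr A.
have lt1 z : eigenvalue Ac z -> `|z| < 1.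
  move=> ze; rewrite lt_neqAle hyp//=; apply: (le_trans (mu_max _ ze)).
  by rewrite lecR.
have [rs prs] := closed_field_poly_normal (char_poly Ac).
rewrite (monicP (char_poly_monic _)) scale1r in prs.
have rsP z : z \in rs -> `|z| < 1.
  move=> zrs; apply: lt1; rewrite eigenvalue_root_char prs.
  by rewrite root_prod_XsubC.
have det1 : `|\det Ac| = 1.
  rewrite det_map_mx; have : \det A \is a GRing.unit by rewrite -unitmxE.
  by move=> /orP[]/eqP->; rewrite ?rmorphN rmorph1 ?normrN normr1.
have p0 : `|(char_poly Ac).[0]| = 1.
  by rewrite horner_coef0 char_poly_det normrM normrX normrN1 expr1n mul1r.
have rs_ne : rs != [::].
  apply/eqP => rs0; move: z0e; rewrite /is_eigenvalue eigenvalue_root_char prs rs0.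
  by rewrite big_nil (negPf (root1 _)).
have : `|(char_poly Ac).[0]| < 1.
  rewrite prs horner_prod normr_prod; case: rs rs_ne rsP {prs} => // z rs _ rsP.
  rewrite big_cons hornerXsubC sub0r normrN.
  apply: (@le_lt_trans _ _ (`|z| * 1)); last by rewrite mulr1 rsP// mem_head.
  rewrite ler_wpM2l//; elim: rs rsP => [|y rs IH] rsP; first by rewrite big_nil.
  rewrite big_cons hornerXsubC sub0r normrN mulr_ile1//.
  - by apply: prodr_ge0.
  - by rewrite ltW// rsP// !inE eqxx orbT.
  - by apply: IH => y' y'rs; apply: rsP; move: y'rs; rewrite !inE => /orP[->|->]//; rewrite !orbT.
by rewrite p0 ltxx.
Qed.

(** * One-sided derivatives *)

Section Jets.
Variables (R : realType) (D : set R).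
Implicit Types (u v : R -> R) (J : nat -> R -> R) (x y l e K M : R).

(** A relational form of iterated derivatives: it asserts convergence, whereas [derive_in] is a
    [lim] and says nothing unless the limit exists. *)
Definition jet n J := forall i x, (i < n)%N -> D x ->
  diff_quotient (J i) x y @[y --> within D x^'] --> J i.+1 x.

Hypothesis D_proper : forall x, D x -> ProperFilter (within D x^').

Lemma diff_quotient_eq u v x l : (forall y, D y -> u y = v y) -> D x ->
  diff_quotient u x y @[y --> within D x^'] --> l ->
  diff_quotient v x y @[y --> within D x^'] --> l.
Proof.
move=> uv Dx; apply: cvg_trans; apply: near_eq_cvg; near=> y.
have Dy : D y by near: y; exact: withinT.
by rewrite /diff_quotient !uv.
Unshelve. all: by end_near. Qed.

Lemma jet_derive_in_n n J u : (forall x, D x -> u x = J 0%N x) -> jet n J ->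
  forall i, (i <= n)%N -> forall x, D x -> derive_in_n D i u x = J i x.
Proof.
move=> u0 hJ; elim=> [|i IH] ni x Dx; first exact: u0.
have PF := D_proper Dx; apply/cvg_lim => //.
apply: (@diff_quotient_eq (J i)) => //; last exact: hJ.
by move=> y Dy; apply/esym; exact: (IH (ltnW ni) y Dy).
Qed.

Lemma jet_derivable_in n J u : (forall x, D x -> u x = J 0%N x) -> jet n J ->
  forall i, (i < n)%N -> forall x, D x -> derivable_in D (derive_in_n D i u) x.
Proof.
move=> u0 hJ i ni x Dx; apply/cvg_ex; exists (J i.+1 x).
apply: (@diff_quotient_eq (J i)) => //; last exact: hJ.
by move=> y Dy; apply/esym; exact: (jet_derive_in_n u0 hJ (ltnW ni) Dy).
Qed.

Lemma class_C_jet n u : class_C n D u -> jet n (fun i => derive_in_n D i u).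
Proof. by move=> [h _] i x ni Dx; exact: h. Qed.

Lemma jetB n J J' : jet n J -> jet n J' -> jet n (fun i x => J i x - J' i x).
Proof.
move=> hJ hJ' i x ni Dx.
rewrite (_ : diff_quotient _ x = fun y => diff_quotient (J i) x y - diff_quotient (J' i) x y).
  by apply: cvgB; [exact: hJ|exact: hJ'].
by apply/funext => y; rewrite /diff_quotient -mulrBl; congr (_ / _); ring.
Qed.

(** The bridge from remainder estimates back to derivatives defined by limits. *)
Lemma diff_quotient_cvg u x l g K : 0 < g -> 0 <= K -> D x ->
  (forall y, D y -> `|u y - u x - l * (y - x)| <= K * (`|y - x| * `|y - x| `^ g)) ->
  diff_quotient u x y @[y --> within D x^'] --> l.
Proof.
move=> g0 K0 Dx h; apply/cvgrPdist_lt => e e0.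
have [r r0 hr] := powR_small g0 K0 e0.
have H : \forall y \near x, y != x -> D y -> `|l - diff_quotient u x y| < e.
  near=> y => yx Dy; have yx0 : y - x != 0 by rewrite subr_eq0.
  have yr : 0 <= `|y - x| <= r.
    rewrite normr_ge0 /= distrC; near: y.
    by apply: (@cvgr_dist_le _ _ _ (nbhs x) _ id) => //; exact: cvg_id.
  apply: le_lt_trans (hr _ yr).
  have -> : l - diff_quotient u x y = - ((u y - u x - l * (y - x)) / (y - x)).
    by rewrite /diff_quotient; field.
  rewrite normrN normrM normfV ler_pdivrMr ?normr_gt0//.
  by apply: (le_trans (h _ Dy)); rewrite -mulrA (mulrC (`|y - x|)).
have H' : \forall y \near x^', D y -> `|l - diff_quotient u x y| < e.
  by rewrite /dnbhs near_withinE.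
by rewrite near_withinE.
Unshelve. all: by end_near. Qed.

Lemma norm_C_le n J u (j : nat) K : (forall x, D x -> u x = J 0%N x) -> jet n J ->
  (j <= n)%N -> 0 <= K -> (forall i x, (i <= j)%N -> D x -> `|J i x| <= K) ->
  (norm_C j D u <= K%:E)%E.
Proof.
move=> u0 hJ jn K0 JK; rewrite /norm_C; apply: (big_ind (fun z => (z <= K%:E)%E)) =>
    [|s t sK tK|i _]; first by rewrite lee_fin.
  by rewrite ge_max sK tK.
apply: ge_ereal_sup => _ [x Dx <-]; rewrite lee_fin.
have ij : (i <= j)%N by rewrite -ltnS.
by rewrite (jet_derive_in_n u0 hJ) ?(leq_trans ij)//; exact: JK.
Qed.

Lemma le_norm_C k u K : (norm_C k D u <= K%:E)%E ->
  forall i x, (i <= k)%N -> D x -> `|derive_in_n D i u x| <= K.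
Proof.
move=> uK i x ik Dx; rewrite -lee_fin; apply: le_trans uK.
apply: (@le_trans _ _ (ereal_sup [set `|derive_in_n D i u x|%:E | x in D])).
  by apply: ereal_sup_ubound; exists x.
rewrite /norm_C.
exact: (@le_bigmax _ _ _ 0%E (fun i : 'I_k.+1 =>
  ereal_sup [set `|derive_in_n D i u x|%:E | x in D]) (Ordinal (ik : (i < k.+1)%N))).
Qed.

End Jets.

(** * Mean values on the unit interval, and positivity of the multiplier *)

Section UnitInterval.
Variable R : realType.
Implicit Types (u v w : R -> R) (x y z M : R).

Lemma half_open_punctured_proper e x : 0 <= x < e ->
  ProperFilter (within [set` `[(0:R), e[] x^').
Proof.
move=> /andP[x0 xe]; apply: Build_ProperFilter_ex => P.
rewrite /within /= => -[r /= r0 hr].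
pose t := Num.min r (e - x) / 2.
have t0 : 0 < t by rewrite divr_gt0// lt_min r0 subr_gt0.
have tr : t < r.
  rewrite ltr_pdivrMr//; have : Num.min r (e - x) <= r by rewrite ge_min lexx.
  lra.
have te : t < e - x.
  rewrite ltr_pdivrMr//; have : Num.min r (e - x) <= e - x by rewrite ge_min lexx orbT.
  lra.
exists (x + t); apply: hr => /=.
- by rewrite opprD addrA subrr sub0r normrN gtr0_norm.
- by rewrite -subr_eq0 addrAC subrr add0r gt_eqF.
- by rewrite in_itv /=; apply/andP; split; lra.
Qed.

Lemma unit_punctured_proper x : [set` `[(0:R), 1]] x ->
    ProperFilter (within [set` `[(0:R), 1]] x^').
Proof.
rewrite /= in_itv /= => /andP[x0 x1]; apply: Build_ProperFilter_ex => P.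
rewrite /within /= => -[r /= r0 hr].
pose t := Num.min r (1 / 2) / 2.
have t0 : 0 < t by rewrite divr_gt0// lt_min r0 divr_gt0.
have tr : t < r.
  rewrite ltr_pdivrMr//; have : Num.min r (1 / 2) <= r by rewrite ge_min lexx.
  lra.
have te : t <= 1 / 4.
  have : Num.min r (1 / 2) <= 1 / 2 by rewrite ge_min lexx orbT.
  rewrite /t; lra.
have [xh|xh] := leP x (1 / 2).
  exists (x + t); apply: hr => /=.
  - by rewrite opprD addrA subrr sub0r normrN gtr0_norm.
  - by rewrite -subr_eq0 addrAC subrr add0r gt_eqF.
  - by rewrite in_itv /=; apply/andP; split; lra.
exists (x - t); apply: hr => /=.
- by rewrite opprB addrC subrK gtr0_norm.
- by rewrite -subr_eq0 addrAC subrr add0r oppr_eq0 gt_eqF.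
- by rewrite in_itv /=; apply/andP; split; lra.
Qed.

Lemma is_derive_interior u l z : 0 < z < 1 ->
  diff_quotient u z y @[y --> within [set` `[(0:R), 1]] z^'] --> l -> is_derive z 1 u l.
Proof.
move=> /andP[z0 z1] h.
suff H : h^-1 *: ((u \o shift z) (h *: (1:R)) - u z) @[h --> 0^'] --> l.
  by apply: DeriveDef; [apply/cvg_ex; exists l|exact/cvg_lim].
apply/cvgrPdist_lt => e e0.
move/cvgrPdist_lt/(_ _ e0) : h; rewrite near_withinE => -[r /= r0 hr].
have small s : 0 < s -> \forall t \near (0:R)^', `|t| < s.
  move=> s0; apply: nbhs_dnbhs; apply/nbhs_ballP; exists s => //= t'.
  by rewrite /ball /= sub0r normrN.
near=> t.
have t0 : t != 0 by near: t; exact: nbhs_dnbhs_neq.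
have tr : `|t| < r by near: t; exact: small.
have tz : `|t| < z by near: t; exact: small.
have tz1 : `|t| < 1 - z by near: t; apply: small; rewrite subr_gt0.
have /ltr_normlP[tz' tz''] := tz; have /ltr_normlP[tz1' tz1''] := tz1.
have := hr (t + z); rewrite /diff_quotient /= /GRing.scale /= mulr1.
rewrite -[t + z - z]addrA subrr addr0 [in X in _ -> X]mulrC; apply.
- by rewrite opprD addrCA subrr addr0 normrN.
- by rewrite -subr_eq0 -addrA subrr addr0.
- by rewrite in_itv /=; apply/andP; split; lra.
Unshelve. all: by end_near. Qed.

Lemma unit_MVT u v : {within [set` `[(0:R), 1]], continuous u} ->
  (forall x, [set` `[(0:R), 1]] x ->
    diff_quotient u x y @[y --> within [set` `[(0:R), 1]] x^'] --> v x) ->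
  forall x y, 0 <= x <= 1 -> 0 <= y <= 1 ->
  exists2 z, 0 <= z <= 1 /\ `|z - x| <= `|y - x| & u y - u x = v z * (y - x).
Proof.
move=> uc uv.
have mvt s t : 0 <= s <= 1 -> 0 <= t <= 1 -> s <= t ->
    exists2 z, s <= z <= t & u t - u s = v z * (t - s).
  move=> sc tc st; have [z||z zst E] := @MVT_segment R u v s t st.
  - rewrite in_itv /= => /andP[sz zt]; apply: is_derive_interior; first by apply/andP; split; lra.
    by apply: uv; rewrite /= in_itv /=; apply/andP; split; lra.
  - apply: continuous_subspaceW uc => w; rewrite /= !in_itv /=; lra.
  - by exists z => //; move: zst; rewrite in_itv.
move=> x y xc yc; have [xy|/ltW yx] := leP x y.
  have [z zxy E] := mvt _ _ xc yc xy; exists z => //; split; first by apply/andP; split; lra.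
  by rewrite !ger0_norm; lra.
have [z zxy E] := mvt _ _ yc xc yx; exists z; last by rewrite -[LHS]opprB E; ring.
by split; [apply/andP; split; lra|rewrite !ler0_norm; lra].
Qed.

Lemma unit_bounded u : {within [set` `[(0:R), 1]], continuous u} ->
  exists2 M, 0 <= M & forall x, 0 <= x <= 1 -> `|u x| <= M.
Proof.
move=> uc; have [p _ hp] := EVT_max (@ler01 R) uc; have [q _ hq] := EVT_min (@ler01 R) uc.
exists (`|u p| + `|u q|); first by rewrite addr_ge0.
move=> x xc.
have xI : x \in `[(0:R), 1] by rewrite in_itv.
have h1 := hp x xI; have h2 := hq x xI.
have n1 := ler_norm (u p); have n2 := ler_norm (- u q); rewrite normrN in n2.
have n3 := normr_ge0 (u p); have n4 := normr_ge0 (u q).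
by rewrite ler_norml; apply/andP; split; lra.
Qed.

(** Monotonicity only yields l >= 0. The inverse is C^1, hence Lipschitz with some constant M, so y
    <= M u(y) and the difference quotients at 0 are at least 1/(M + 1). *)
Lemma diffeo_derive_gt0 u l : orientation_preserving_diffeo [set` `[(0:R), 1]] u -> u 0 = 0 ->
  diff_quotient u 0 y @[y --> within [set` `[(0:R), 1]] 0^'] --> l -> 0 < l.
Proof.
move=> [[fu iu su] uC [w [wC uK wK]] mono] u0 ul.
have I0 : [set` `[(0:R), 1]] 0 by rewrite /= in_itv /= lexx ler01.
have PF := unit_punctured_proper I0.
have [wd wcont] := wC.
have [M M0 wM] := unit_bounded (wcont 1%N isT).
have w_lip y : 0 <= y <= 1 -> `|w y - w 0| <= M * `|y - 0|.
  move=> yc; have I0' : 0 <= (0:R) <= 1 by rewrite lexx ler01.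
  have [z [zc _] ->] := unit_MVT (wcont 0%N isT) (fun x Dx => wd 0%N x isT Dx) I0' yc.
  by rewrite normrM ler_wpM2r// wM.
have M1 : 0 < M + 1 by lra.
suff : (M + 1)^-1 <= l by apply: lt_le_trans; rewrite invr_gt0.
have <- : limn (fun _ : nat => l) = l by exact: lim_cst.
rewrite lim_cst//; have -> : l = lim (diff_quotient u 0 y @[y --> within [set` `[(0:R), 1]] 0^']).
  by apply/esym/cvg_lim.
apply: limr_ge; first by apply/cvg_ex; exists l.
have H : \forall y \near within [set` `[(0:R), 1]] 0^', [set` `[(0:R), 1]] y /\ y != 0.
  rewrite near_withinE; near=> y => yI; split=> //.
  by near: y; exact: nbhs_dnbhs_neq.
apply: filterS H => y [yI y0]; have yI' := yI; rewrite /= in_itv /= in yI'.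
have ypos : 0 < y by case/andP: yI' => h _; rewrite lt_neqAle eq_sym y0.
have uyI : [set` `[(0:R), 1]] (u y) by exact: fu.
have uyI' := uyI; rewrite /= in_itv /= in uyI'.
have uy0 : 0 <= u y by case/andP: uyI'.
have h := w_lip _ uyI'.
have w0 : w 0 = 0 by rewrite -{1}u0 uK// inE.
rewrite w0 uK ?inE// !subr0 !ger0_norm// in h; last exact: ltW.
rewrite /diff_quotient u0 !subr0 ler_pdivlMr// ler_pdivrMl//.
by apply: (le_trans h); rewrite mulrDl mul1r lerDl.
Unshelve. all: by end_near. Qed.

End UnitInterval.

(** * The linearization over the torus *)

Section Cutoff.
Variables (R : realType) (r : R).
Hypothesis r0 : 0 < r.
Implicit Types s t : R.

Definition cutoff t := if t <= r then 1 else if 2 * r <= t then 0 else 2 - t / r.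

Lemma cutoff_bounds t : 0 <= cutoff t <= 1.
Proof.
rewrite /cutoff; have [_|rt] := leP t r; first by rewrite ler01 lexx.
have [_|tr] := leP (2 * r) t; first by rewrite ler01 lexx.
have h1 : 1 <= t / r by rewrite ler_pdivlMr// mul1r ltW.
have h2 : t / r <= 2 by rewrite ler_pdivrMr// ltW.
by apply/andP; split; lra.
Qed.

Lemma cutoff_lip s t : `|cutoff s - cutoff t| <= `|s - t| / r.
Proof.
wlog st : s t / s <= t => [hw|].
  have [st|/ltW ts] := leP s t; first exact: hw.
  by rewrite distrC (distrC s); exact: hw.
have h u : cutoff u = 2 - (if u <= r then 1 else if 2 * r <= u then 2 else u / r).
  by rewrite /cutoff; case: ifP => _; [ring|case: ifP => _; ring].
have E : `|s - t| / r = t / r - s / r.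
  by rewrite distrC ger0_norm ?subr_ge0// mulrBl.
have str : s / r <= t / r by rewrite ler_pM2r ?invr_gt0.
have lo u : r < u -> 1 <= u / r by move=> ru; rewrite ler_pdivlMr// mul1r ltW.
have lo' u : u <= r -> u / r <= 1 by move=> ru; rewrite ler_pdivrMr// mul1r.
have up u : u < 2 * r -> u / r <= 2 by move=> ru; rewrite ler_pdivrMr// ltW.
have up' u : 2 * r <= u -> 2 <= u / r by move=> ru; rewrite ler_pdivlMr.
rewrite E !h ler_norml; have [s1|/lo s1] := leP s r; have [t1|/lo t1] := leP t r;
  have [s2|/up s2] := leP (2 * r) s; have [t2|/up t2] := leP (2 * r) t;
  try (have s1' := lo' _ s1); try (have t1' := lo' _ t1);
  try (have s2' := up' _ s2); try (have t2' := up' _ t2);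
  apply/andP; split; lra.
Qed.
End Cutoff.

Section TorusLinearization.
Variables (R : realType) (d n : nat) (A : 'M[int]_d) (f : torus R d -> R -> R).
Variables (Ck beta : R) (b0 : torus R d).
Let I01 : set R := [set` `[0, 1]].
Let J b i := derive_in_n I01 i (f b).
Hypothesis fC : forall b, class_C n.+2 I01 (f b).
Hypotheses (Ck0 : 0 < Ck) (beta0 : 0 < beta).
Hypothesis fh : forall b b', (norm_C n.+2 I01 (f b \- f b')%R
                 <= (Ck * torus_dist b b' `^ beta)%:E)%E.

(* The second summand makes the cutoff Lipschitz also when beta > 1. *)
Definition modulus (b b' : torus R d) : R := torus_dist b b' `^ beta + torus_dist b b'.

Lemma modulus_ge0 b b' : 0 <= modulus b b'.
Proof. by rewrite addr_ge0 ?powR_ge0 ?torus_dist_ge0. Qed.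

Lemma modulus_refl b : modulus b b = 0.
Proof. by rewrite /modulus torus_dist_refl powR0 ?addr0// gt_eqF. Qed.

Lemma modulus_torus_map (C : 'M[int]_d) : exists2 L, 0 <= L &
  forall b b', modulus (torus_map C b) (torus_map C b') <= L * modulus b b'.
Proof.
have [L L0 hL] := @torus_map_lip R d C.
exists (L `^ beta + L) => [|b b']; first by rewrite addr_ge0 ?powR_ge0.
have d0 := torus_dist_ge0 b b'.
have h1 : torus_dist (torus_map C b) (torus_map C b') `^ beta <= L `^ beta * torus_dist b b' `^
    beta.
  by rewrite -powRM//; apply: powR_mono; [rewrite torus_dist_ge0 hL|exact: ltW].
have h2 := hL b b'.
have h3 : 0 <= L `^ beta * torus_dist b b' by rewrite mulr_ge0 ?powR_ge0.
have h4 : 0 <= L * torus_dist b b' `^ beta by rewrite mulr_ge0 ?powR_ge0.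
rewrite /modulus mulrDl !mulrDr; lra.
Qed.

Let in01 x : I01 x = (0 <= x <= 1) :> Prop.
Proof. by rewrite /I01 /= in_itv. Qed.

Let acc01 x : I01 x -> ProperFilter (within I01 x^').
Proof. exact: unit_punctured_proper. Qed.

Lemma derivatives_dist b b' i x : (i <= n.+2)%N -> 0 <= x <= 1 ->
  `|J b i x - J b' i x| <= Ck * torus_dist b b' `^ beta.
Proof.
move=> ik xc; have xI : I01 x by rewrite in01.
have := le_norm_C (fh b b') ik xI.
by rewrite (@jet_derive_in_n _ I01 acc01 n.+2 (fun i x => J b i x - J b' i x))//;
  apply: jetB; exact: class_C_jet.
Qed.

Lemma derivative_MVT b i x y : (i < n.+2)%N -> 0 <= x <= 1 -> 0 <= y <= 1 ->
  exists2 z, 0 <= z <= 1 /\ `|z - x| <= `|y - x| & J b i y - J b i x = J b i.+1 z * (y - x).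
Proof.
move=> ik; apply: unit_MVT; first exact: ((fC b).2 i (ltnW ik)).
by move=> z zI; apply: (class_C_jet (fC b)).
Qed.

Let lam := J b0 1 0.

Lemma torus_linearization : A \in unitmx -> 0 < lam -> lam != 1 -> (forall b, f b 0 = 0) ->
  exists r c eps (H H' Phi : torus R d -> R -> R),
    [/\ 0 < r <= 1 / 4, 0 < eps <= c, c <= 1 &
    [/\ [/\ holder modulus eps H, fiber_derivative eps H H', holder_class modulus n eps H' &
        holder modulus c Phi],
      forall b, H b 0 = 0 /\ H' b 0 = 1,
      forall b x, torus_dist b b0 < r -> 0 <= x <= eps -> 0 <= J b 1 0 * x <= eps ->
        f b (H b x) = H (torus_map A b) (J b 1 0 * x) &
      forall b x, 0 <= x <= eps -> 0 <= H b x <= c /\ Phi b (H b x) = x]].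
Proof.
move=> Au lam0 lam1 f0.
(* The interval from lam - del to lam + del is positive and stays on one side of 1. One half of del
   is spent on varying b, the other half on varying x. *)
pose del := Num.min lam `|1 - lam| / 2.
have del0 : 0 < del by rewrite divr_gt0// lt_min lam0 normr_gt0 subr_eq0 eq_sym.
have del_lam : del <= lam / 2 by rewrite /del ler_pM2r// ge_min lexx.
have del_1 : del <= `|1 - lam| / 2 by rewrite /del ler_pM2r// ge_min lexx orbT.
have [M0 M00 M0b] : exists2 M, 0 <= M &
    forall i x, (i <= n.+2)%N -> 0 <= x <= 1 -> `|J b0 i x| <= M.
  have /choice[m hm] : forall i : nat, exists M, (i <= n.+2)%N -> 0 <= M /\
      forall x, 0 <= x <= 1 -> `|J b0 i x| <= M.
    move=> i; have [ik|] := boolP (i <= n.+2)%N; last by exists 0.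
    by have [M M0 hM] := unit_bounded ((fC b0).2 i ik); exists M.
  have m0 (i : 'I_n.+3) : 0 <= m i by have [] := hm i (ltn_ord i).
  exists (\sum_(i < n.+3) m i); first by apply: sumr_ge0 => i _.
  move=> i x ik xc; have [_ h] := hm i ik; apply: (le_trans (h x xc)).
  by rewrite (bigD1 (Ordinal (ik : (i < n.+3)%N)))//= lerDl sumr_ge0.
have del2 : 0 < del / 2 by rewrite divr_gt0.
have [rr rr0 hrr] := powR_small beta0 (ltW Ck0) del2.
(* The cutoff is supported in radius 2 r <= rr, where the derivatives differ from those at b0 by
   less than del/2. The bound 1/4 keeps any two points of the ball V at distance at most 1. *)
pose r := Num.min (rr / 2) (1 / 4).
have r0 : 0 < r by rewrite lt_min !divr_gt0.
have r4 : r <= 1 / 4 by rewrite /r ge_min lexx orbT.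
have r2 : 2 * r <= rr.
  have : r <= rr / 2 by rewrite /r ge_min lexx.
  lra.
pose chi b := cutoff r (torus_dist b b0).
have chi01 b : 0 <= chi b <= 1 by exact: cutoff_bounds.
have chi0 b : chi b = 0 \/ torus_dist b b0 <= 2 * r.
  rewrite /chi /cutoff; have [h|h] := leP (torus_dist b b0) r; first by right; lra.
  by have [|/ltW] := leP (2 * r) (torus_dist b b0); [left|right].
have chi1 b : torus_dist b b0 < r -> chi b = 1 by move=> /ltW h; rewrite /chi /cutoff h.
have chi_lip b b' : `|chi b - chi b'| <= torus_dist b b' / r.
  apply: (le_trans (cutoff_lip r0 _ _)); rewrite ler_pM2r ?invr_gt0//.
  have t1 := torus_dist_triangle b b' b0; have t2 := torus_dist_triangle b' b b0.
  rewrite (torus_dist_sym b' b) in t2.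
  by rewrite ler_norml; apply/andP; split; lra.
have near_b0 b i x : torus_dist b b0 <= 2 * r -> (i <= n.+2)%N -> 0 <= x <= 1 ->
    `|J b i x - J b0 i x| <= del / 2.
  move=> br ik xc; apply: (le_trans (derivatives_dist _ _ ik xc)); apply: ltW.
  by apply: hrr; rewrite torus_dist_ge0 (le_trans br).
pose M1 := M0 + del.
have M10 : 0 <= M1 by rewrite addr_ge0// ltW.
have good b : torus_dist b b0 <= 2 * r -> forall i x, (i <= n.+2)%N -> 0 <= x <= 1 ->
    `|J b i x| <= M1.
  move=> br i x ik xc; have -> : J b i x = J b0 i x + (J b i x - J b0 i x) by ring.
  apply: (le_trans (ler_normD _ _)); apply: lerD; first exact: M0b.
  by apply: (le_trans (near_b0 _ _ _ br ik xc)); lra.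
have good0 : torus_dist b0 b0 <= 2 * r by rewrite torus_dist_refl; lra.
have good_lip b : torus_dist b b0 <= 2 * r -> forall i x y, (i < n.+2)%N ->
    0 <= x <= 1 -> 0 <= y <= 1 -> `|J b i y - J b i x| <= M1 * `|y - x|.
  move=> br i x y ik xc yc; have [z [zc _] ->] := derivative_MVT b ik xc yc.
  by rewrite normrM ler_wpM2r// good.
have good_der b : torus_dist b b0 <= 2 * r -> forall i x y, (i.+1 < n.+2)%N ->
    0 <= x <= 1 -> 0 <= y <= 1 ->
    `|J b i y - J b i x - J b i.+1 x * (y - x)| <= M1 * (`|y - x| * `|y - x|).
  move=> br i x y ik xc yc; have [z [zc zx] ->] := derivative_MVT b (ltnW ik) xc yc.
  rewrite -mulrBl normrM mulrA; apply: ler_wpM2r => //.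
  by apply: (le_trans (good_lip _ br _ _ _ ik xc zc)); exact: ler_wpM2l.
(* As chi does not depend on x, cutting off commutes with fiber derivatives. Each [Jt] is a convex
   combination, so bounds common to b0 and the support of chi pass to it. *)
pose Jt i b x := J b0 i x + chi b * (J b i x - J b0 i x).
have convex b (s t K : R) : `|s| <= K -> (torus_dist b b0 <= 2 * r -> `|t| <= K) ->
    `|s + chi b * (t - s)| <= K.
  move=> sK tK; have [->|/tK {}tK] := chi0 b; first by rewrite mul0r addr0.
  have /andP[c0 c1] := chi01 b.
  have -> : s + chi b * (t - s) = (1 - chi b) * s + chi b * t by ring.
  apply: (le_trans (ler_normD _ _)); rewrite !normrM (ger0_norm c0).
  rewrite (@ger0_norm _ (1 - chi b)) ?subr_ge0//.
  have := ler_wpM2l c0 tK; have := ler_wpM2l (_ : 0 <= 1 - chi b) sK.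
  by rewrite subr_ge0 => /(_ c1); lra.
have Jt_b0 i b x : (i <= n.+2)%N -> 0 <= x <= 1 -> `|Jt i b x - J b0 i x| <= del / 2.
  move=> ik xc; rewrite /Jt addrAC subrr add0r normrM.
  have [->|br] := chi0 b; first by rewrite normr0 mul0r ltW.
  have /andP[c0 c1] := chi01 b; rewrite (ger0_norm c0).
  by rewrite -[leRHS]mul1r; apply: ler_pM => //; exact: near_b0.
have Jt_M1 i b x : (i <= n.+2)%N -> 0 <= x <= 1 -> `|Jt i b x| <= M1.
  by move=> ik xc; apply: convex => [|br]; exact: good.
have Jt_lip i b x y : (i < n.+2)%N -> 0 <= x <= 1 -> 0 <= y <= 1 ->
    `|Jt i b y - Jt i b x| <= M1 * `|y - x|.
  move=> ik xc yc; have -> : Jt i b y - Jt i b x = (J b0 i y - J b0 i x)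
    + chi b * ((J b i y - J b i x) - (J b0 i y - J b0 i x)) by rewrite /Jt; ring.
  by apply: convex => [|br]; exact: good_lip.
have Jt_der i b x y : (i.+1 < n.+2)%N -> 0 <= x <= 1 -> 0 <= y <= 1 ->
    `|Jt i b y - Jt i b x - Jt i.+1 b x * (y - x)| <= M1 * (`|y - x| * `|y - x|).
  move=> ik xc yc; have -> : Jt i b y - Jt i b x - Jt i.+1 b x * (y - x) =
     (J b0 i y - J b0 i x - J b0 i.+1 x * (y - x)) + chi b *
     ((J b i y - J b i x - J b i.+1 x * (y - x)) - (J b0 i y - J b0 i x - J b0 i.+1 x * (y - x))).
    by rewrite /Jt; ring.
  by apply: convex => [|br]; exact: good_der.
(* Ck comes from the hypothesis on f; the other summand is the slope 1/r of the cutoff times the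
   bound del/2 for the quantity it multiplies. *)
pose Lb := Ck + del / (2 * r).
have rdel : 0 < del / (2 * r) by rewrite divr_gt0// mulr_gt0.
have Lb0 : 0 <= Lb by move: (Ck0); rewrite /Lb; lra.
have Jt_base i b b' x : (i <= n.+2)%N -> 0 <= x <= 1 ->
    `|Jt i b x - Jt i b' x| <= Lb * modulus b b'.
  (* One of the two points in the support of the cutoff suffices, by symmetry; if neither is, both
     fiber maps equal that of b0. *)
  have main c c' : torus_dist c' b0 <= 2 * r -> (i <= n.+2)%N -> 0 <= x <= 1 ->
      `|Jt i c x - Jt i c' x| <= Lb * modulus c c'.
    move=> cr ik xc; have -> : Jt i c x - Jt i c' x =
      chi c * (J c i x - J c' i x) + (chi c - chi c') * (J c' i x - J b0 i x).
      by rewrite /Jt; ring.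
    have /andP[c0 c1] := chi01 c.
    have h1 : `|chi c * (J c i x - J c' i x)| <= 1 * (Ck * torus_dist c c' `^ beta).
      by apply: ler_normM; [rewrite ger0_norm|exact: derivatives_dist].
    have h2 := ler_normM (chi_lip c c') (near_b0 _ _ _ cr ik xc).
    have h3 : torus_dist c c' / r * (del / 2) = del / (2 * r) * torus_dist c c'.
      by field; rewrite gt_eqF.
    rewrite h3 in h2; rewrite mul1r in h1.
    have h4 : 0 <= Ck * torus_dist c c' by rewrite mulr_ge0 ?torus_dist_ge0// ltW.
    have h5 : 0 <= del / (2 * r) * torus_dist c c' `^ beta.
      by rewrite mulr_ge0 ?powR_ge0// ltW.
    by apply: (le_trans (ler_normD _ _)); apply: (le_trans (lerD h1 h2)); exact: cross_sum_le.
  move=> ik xc; have [c'0|] := chi0 b'; last by move=> br; exact: main.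
  have [cb0|br] := chi0 b.
    by rewrite /Jt cb0 c'0 !mul0r subrr normr0 mulr_ge0// modulus_ge0.
  by rewrite distrC /modulus torus_dist_sym; exact: main.
have Jt_joint i b b' x x' : (i < n.+2)%N -> 0 <= x <= 1 -> 0 <= x' <= 1 ->
    `|Jt i b x - Jt i b' x'| <= (M1 + Lb) * rho modulus b b' x x'.
  move=> ik xc xc'; have -> : Jt i b x - Jt i b' x' =
    (Jt i b x - Jt i b x') + (Jt i b x' - Jt i b' x') by ring.
  apply: (le_trans (ler_normD _ _)).
  have h1 := Jt_lip i b x' x ik xc' xc; have h2 := Jt_base i b b' x' (ltnW ik) xc'.
  have h3 : M1 * `|x - x'| <= M1 * rho modulus b b' x x'.
    by rewrite ler_wpM2l// /rho lerDr modulus_ge0.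
  have h4 : Lb * modulus b b' <= Lb * rho modulus b b' x x'.
    by rewrite ler_wpM2l// /rho lerDl.
  rewrite mulrDl; exact: le_trans (lerD h1 h2) (lerD h3 h4).
(* Over [0, c] the derivative of f at b0 varies by at most M1 c <= del/2. *)
pose c := Num.min 1 (del / (2 * (M1 + 1))).
have M11 : 0 < M1 + 1 by rewrite ltr_wpDl.
have c0 : 0 < c by rewrite lt_min ltr01 divr_gt0// mulr_gt0.
have c1 : c <= 1 by rewrite ge_min lexx.
have cM1 : M1 * c <= del / 2.
  apply: (@le_trans _ _ ((M1 + 1) * (del / (2 * (M1 + 1))))).
    by apply: ler_pM; rewrite ?(ltW c0)//; [rewrite lerDl|rewrite ge_min lexx orbT].
  by rewrite le_eqVlt; apply/orP; left; apply/eqP; field; rewrite gt_eqF.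
have sub01 x : 0 <= x <= c -> 0 <= x <= 1.
  by move=> /andP[-> /le_trans ->].
(* The top order n + 2 is left out, since that derivative has no modulus of continuity in x; so
   [Jt 1] has class n. *)
have hJt i : (i < n.+2)%N -> holder modulus c (Jt i).
  move=> ik; apply: (@holderI _ _ _ modulus_ge0 _ 1 (M1 + Lb)) => // [b x xc|b b' x x' xc xc' _].
    by apply: (le_trans (Jt_M1 _ _ _ (ltnW ik) (sub01 _ xc))); rewrite lerDl.
  rewrite powRr1; last exact: (rho_ge0 modulus_ge0).
  by apply: Jt_joint => //; exact: sub01.
have dJt i : (i.+1 < n.+2)%N -> fiber_derivative c (Jt i) (Jt i.+1).
  move=> ik; apply: (@fiber_derivativeI _ _ _ 1 M1) => // b x y xc yc.
  by rewrite powRr1//; apply: Jt_der => //; exact: sub01.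
have [LA LA0 hLA] := modulus_torus_map A.
have [LB LB0 hLB] := modulus_torus_map (invmx A).
pose L := LA + LB + (M1 + Lb).
have MLb0 : 0 <= M1 + Lb by exact: addr_ge0.
have L0 : 0 <= L by apply: addr_ge0 => //; exact: addr_ge0.
have TL b b' : modulus (torus_map A b) (torus_map A b') <= L * modulus b b'.
  apply: (le_trans (hLA b b')); rewrite ler_wpM2r ?modulus_ge0// /L -[LA + LB + _]addrA lerDl.
  exact: addr_ge0.
have T'L b b' : modulus (torus_map (invmx A) b) (torus_map (invmx A) b') <= L * modulus b b'.
  apply: (le_trans (hLB b b')); rewrite ler_wpM2r ?modulus_ge0// /L addrAC lerDr.
  exact: addr_ge0.
have fL b b' x x' : 0 <= x <= c -> 0 <= x' <= c ->
    `|Jt 0%N b x - Jt 0%N b' x'| <= L * rho modulus b b' x x'.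
  move=> xc xc'; apply: (le_trans (Jt_joint 0%N b b' x x' isT (sub01 _ xc) (sub01 _ xc'))).
  by rewrite ler_wpM2r ?(rho_ge0 modulus_ge0)// /L lerDr addr_ge0.
have F' : holder_class modulus n c (Jt 1%N).
  by apply: (@holder_class_of_family _ _ _ n c (fun i => Jt i.+1)) => i ni; [exact: hJt|exact: dJt].
have k0 : 0 < lam - del.
  by rewrite subr_gt0 (le_lt_trans del_lam)// ltr_pdivrMr// ltr_pMr// ltr1n.
have f'k b x : 0 <= x <= c -> lam - del <= Jt 1%N b x <= lam + del.
  move=> xc; have x01 := sub01 _ xc.
  have I0 : 0 <= (0:R) <= 1 by rewrite lexx ler01.
  have h1 := Jt_b0 1%N b x isT x01.
  have h2 := good_lip b0 good0 1%N 0 x isT I0 x01.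
  have h3 : `|J b0 1%N x - lam| <= del / 2.
    apply: (le_trans h2); rewrite subr0; apply: le_trans cM1; apply: ler_wpM2l => //.
    by have /andP[? ?] := xc; rewrite ger0_norm.
  exact: near_multiplier h1 h3.
have ft0 b : Jt 0%N b 0 = 0 by rewrite /Jt /J /= !f0 subrr mulr0 addr0.
have cases : lam + del < 1 \/ 1 < lam - del /\
    (exists2 T' : torus R d -> torus R d, cancel (torus_map A) T' &
    forall b b', modulus (T' b) (T' b') <= L * modulus b b').
  have [l1|l1] := ltP lam 1.
    by left; exact: (multiplier_gap del_1).1.
  right; split; last by exists (torus_map (invmx A)); [exact: torus_map_invmx|].
  have l1' : 1 < lam by rewrite lt_neqAle eq_sym lam1.
  exact: (multiplier_gap del_1).2.
have [eps [H [H' [eps0 [hH dH hH'] H0 conj [Phi hPhi PhiP]]]]] :=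
  @fiber_linearization R _ modulus modulus_ge0 modulus_refl n c L (lam - del) (lam + del)
   (torus_map A) (Jt 0%N) (Jt 1%N) c0 c1 L0 k0 TL fL (hJt 0%N isT) (dJt 0%N isT) F' f'k ft0 cases.
exists r, c, eps, H, H', Phi; split=> //; first by rewrite r0.
split=> // b x br xe lxe.
have Jb i z : Jt i b z = J b i z by rewrite /Jt chi1// mul1r addrC subrK.
have := conj b x xe; rewrite !Jb => /(_ lxe).
by [].
Qed.
End TorusLinearization.

(** * From the modulus back to the topology and the metric of the torus *)

Section FiberContinuity.
Variables (R : realType) (d : nat) (beta : R).
Hypothesis beta0 : 0 < beta.
Implicit Types (b : torus R d) (u : torus R d -> R -> R).

Lemma modulus_nbhs b s : 0 < s -> nbhs b [set b' | modulus beta b b' <= s].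
Proof.
move=> s0; have s2 : 0 < s / 2 by rewrite divr_gt0.
have [t t0 ht] := powR_small beta0 ler01 s2.
have m0 : 0 < Num.min t (s / 2) by rewrite lt_min t0.
apply: filterS (torus_ball_nbhs b m0) => b' /=; rewrite lt_min => /andP[bt bs].
have := ht (torus_dist b b'); rewrite torus_dist_ge0 (ltW bt) mul1r => /(_ isT) h.
by rewrite /modulus; lra.
Qed.

Lemma fiber_holder_continuous (U : set (torus R d * R)) c u :
  holder (modulus beta) c u -> (forall p, U p -> 0 <= p.2 <= c) ->
  {within U, continuous (fun p : torus R d * R => (p.1, u p.1 p.2))}.
Proof.
move=> /holder_ex[g [K [/andP[g0 _] K0 _ uh]]] Uc.
apply/subspace_continuousP => p Up.
have h1 : fst @ within U (nbhs p) --> p.1.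
  move=> P hP; apply: (@cvg_within _ (nbhs p) _ U).
  exact: (@cvg_fst _ _ (nbhs p.1) (nbhs p.2) _ _ hP).
suff h2 : (fun q : torus R d * R => u q.1 q.2) @ within U (nbhs p) --> u p.1 p.2.
  exact: (@cvg_pair _ _ _ (within U (nbhs p)) (nbhs p.1) (nbhs (u p.1 p.2)) _ _ _ _ _ h1 h2).
apply/cvgrPdist_lt => e e0; have [s s0 hs] := powR_small g0 K0 e0.
have s2 : 0 < s / 2 by rewrite divr_gt0.
have near1 : \forall q \near p, modulus beta p.1 q.1 <= s / 2.
  exact: (@cvg_fst _ _ (nbhs p.1) (nbhs p.2) _ _ (modulus_nbhs p.1 s2)).
have near2 : \forall q \near p, `|p.2 - q.2| <= s / 2.
  have h : \forall y \near p.2, `|p.2 - y| <= s / 2.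
    by apply: (@cvgr_dist_le _ _ _ (nbhs p.2) _ id) => //; exact: cvg_id.
  exact: (@cvg_snd _ _ (nbhs p.1) (nbhs p.2) _ _ h).
near=> q; have Uq : U q by near: q; exact: withinT.
apply: (le_lt_trans (uh _ _ _ _ (Uc _ Up) (Uc _ Uq))); apply: hs.
rewrite (rho_ge0 (modulus_ge0 beta)) /rho /=.
have n1 : modulus beta p.1 q.1 <= s / 2 by near: q; exact: cvg_within near1.
have n2 : `|p.2 - q.2| <= s / 2 by near: q; exact: cvg_within near2.
lra.
Unshelve. all: by end_near. Qed.

(** For distances up to 1, both summands of the modulus are at most the distance to the power
    min(beta, 1). *)
Lemma modulus_powR_le b b' g al : torus_dist b b' <= 1 -> 0 < g ->
  0 < al <= Num.min beta 1 * g -> modulus beta b b' `^ g <= 2 `^ g * torus_dist b b' `^ al.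
Proof.
move=> d1 g0 /andP[al0 alm]; have d0 := torus_dist_ge0 b b'.
have d01 : 0 <= torus_dist b b' <= 1 by rewrite d0.
pose m := Num.min beta 1; have m0 : 0 < m by rewrite lt_min beta0 ltr01.
have h1 : torus_dist b b' `^ beta <= torus_dist b b' `^ m.
  by apply: powR_lower => //; rewrite m0 ge_min lexx.
have h2 : torus_dist b b' <= torus_dist b b' `^ m.
  by apply: powR_self => //; rewrite m0 ge_min lexx orbT.
apply: (@le_trans _ _ ((2 * torus_dist b b' `^ m) `^ g)).
  apply: powR_mono; last exact: ltW.
  by rewrite modulus_ge0 /modulus; lra.
rewrite powRM ?powR_ge0// ler_wpM2l ?powR_ge0// -powRrM.
by apply: powR_lower => //; rewrite al0.
Qed.
End FiberContinuity.

Theorem theorem1 (R : realType) (d k : nat) (A : 'M[int]_d)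
    (f : torus R d -> R -> R) (Ck beta mu q : R) (b0 : torus R d) :
  (2 <= k)%N ->
  boundary_preserving_skew_product A f ->
  (forall b, class_C k `[0, 1] (f b)) ->
  0 < Ck -> 0 < beta ->
  (forall b b', (norm_C k `[0%R, 1%R] (f b \- f b')%R
                 <= (Ck * torus_dist b b' `^ beta)%:E)%E) ->
  hyperbolic_fixed_point A f b0 ->
  largest_eigenvalue_modulus A mu ->
  Num.min (multiplier f b0) (multiplier f b0)^-1 < q -> q < 1 ->
  exists (V : set (torus R d)) (eps : R) (h : torus R d -> R -> R),
    let F := skew_product A f in
    let F0 := linearization A f in
    let H := fiber_map h in
    let U := V `*` [set` `[0, eps[] in
    [/\ nbhs b0 V, 0 < eps & U `<=` @M_set R d] /\
    [/\ homeomorphism_onto_image U H, H @` U `<=` @M_set R d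
      & H (b0, 0) = (b0, 0)] /\
    (forall b, V b -> [/\ h b 0 = 0, derivable_in `[0, eps[ (h b) 0
                        & derive_in `[0, eps[ (h b) 0 = 0]) /\
    (forall p, U p -> U (F0 p) -> F (H p) = H (F0 p)) /\
    (forall b, V b -> class_C (k - 2) `[0, eps[ (fun x => (H (b, x)).2)) /\
    (exists (Ct : nat -> R) (alpha : R),
      [/\ forall l, (l <= k - 2)%N -> 0 < Ct l,
          0 < alpha, alpha < Num.min beta (- (ln q / ln mu))
        & forall l b b', (l <= k - 2)%N -> V b -> V b' ->
            (norm_C l `[0%R, eps[ (h b \- h b')%R
             <= (Ct l * torus_dist b b' `^ alpha)%:E)%E]).
Proof.
move=> k2 [[Au Ahyp] bp] fC Ck0 beta0 fh [fix0 lam1] mumax qmin q1.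
case: k k2 fC fh => [//|[//|n]] _ fC fh.
have -> : (n.+2 - 2 = n)%N by rewrite subn2.
have f0 b : f b 0 = 0 by have [] := bp b.
have I0 : [set` `[(0:R), 1]] 0 by rewrite /= in_itv /= lexx ler01.
have lam0 : 0 < multiplier f b0.
  have [fd _ _] := bp b0; apply: (diffeo_derive_gt0 fd (f0 b0)).
  exact: (class_C_jet (fC b0) (i := 0%N) isT I0).
(* With 0 < q < 1 this makes - log_mu q positive, which leaves room for alpha. *)
have mu1 : 1 < mu by apply: (largest_eigenvalue_modulus_gt1 _ mumax); split.
have q0 : 0 < q by apply: lt_trans qmin; rewrite lt_min lam0 invr_gt0.
pose X := - (ln q / ln mu).
have X0 : 0 < X.
  rewrite oppr_gt0 pmulr_llt0; first by rewrite ln_lt0// q0.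
  by rewrite invr_gt0 ln_gt0.
have [r [c [eps [H [H' [Phi [/andP[r0 r4] /andP[eps0 epsc] c1
  [[hH dH hH' hPhi] H0 conj PhiP]]]]]]]] :=
  torus_linearization fC Ck0 beta0 fh Au lam0 lam1 f0.
have sn0 := @modulus_ge0 R d beta.
have snr := @modulus_refl R d beta beta0.
have H1 : holder_class (modulus beta) n.+1 eps H by split=> //; exists H'.
have [D [D0 hD dD]] := holder_class_family H1.
have [g [K hK]] := holder_uniform hD.
have [/andP[g0 g1] K0 _ _] := hK 0%N isT.
have acc x : [set` `[(0:R), eps[] x -> ProperFilter (within [set` `[(0:R), eps[] x^').
  by rewrite /= in_itv /=; exact: half_open_punctured_proper.
have itv_cc x : [set` `[(0:R), eps[] x -> 0 <= x <= eps.
  by rewrite /= in_itv /= => /andP[-> /ltW].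
have jetH b : jet [set` `[(0:R), eps[] n.+1 (fun i => D i b).
  move=> i x ik xI; have [g' [K' [/andP[g'0 _] K'0 uh]]] := fiber_derivative_ex (dD i ik).
  by apply: (diff_quotient_cvg g'0 K'0 xI) => y yI; apply: uh; exact: itv_cc.
exists [set b | torus_dist b b0 < r], eps, (fun b x => H b x - x) => /=.
have mapE (p : torus R d * R) : fiber_map (fun b x => H b x - x) p = (p.1, H p.1 p.2).
  by rewrite /fiber_map addrC subrK.
set U := _ `*` _.
have Uin p : U p -> 0 <= p.2 <= eps by case=> _ /itv_cc.
have HU p : (fiber_map (fun b x => H b x - x) @` U) p -> 0 <= p.2 <= c.
  by move=> [p' Up' <-]; rewrite mapE /=; have [] := PhiP p'.1 p'.2 (Uin _ Up').
split.
  split=> //.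
    have := torus_ball_nbhs b0 r0; apply: filterS => b /=.
    by rewrite torus_dist_sym.
  move=> p /Uin /andP[p0 pe]; rewrite /M_set /= in_itv /= p0.
  by rewrite (le_trans pe)// (le_trans epsc).
split.
  split.
  - split.
      rewrite (_ : fiber_map _ = fun p => (p.1, H p.1 p.2)); last exact/funext.
      exact: (fiber_holder_continuous beta0 hH Uin).
    exists (fun p => (p.1, Phi p.1 p.2)); split.
      exact: (fiber_holder_continuous beta0 hPhi HU).
    move=> p; rewrite inE => /Uin pe; rewrite mapE /=.
    by have [_ ->] := PhiP p.1 p.2 pe; case: p {pe}.
  - move=> p /HU /andP[p0 pc]; rewrite /M_set /= in_itv /= p0.
    exact: le_trans c1.
  - by rewrite mapE /=; have [-> _] := H0 b0.
split.
  move=> b _; have [Hb0 H'b0] := H0 b.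
  have I0e : [set` `[(0:R), eps[] 0 by rewrite /= in_itv /= lexx.
  have dq : diff_quotient (fun x =>
      H b x - x) 0 y @[y --> within [set` `[(0:R), eps[] 0^'] --> (0 : R).
    have [g' [K' [/andP[g'0 _] K'0 uh]]] := fiber_derivative_ex dH.
    apply: (diff_quotient_cvg g'0 K'0 I0e) => y yI.
    have := uh b 0 y (itv_cc _ I0e) (itv_cc _ yI).
    rewrite Hb0 H'b0 mul1r mul0r !subr0.
    by [].
  have PF := acc _ I0e.
  split; first by rewrite Hb0 subrr.
    by apply/cvg_ex; exists 0.
  exact/cvg_lim.
split.
  (* That F0 p lies in U says that lam_b x is in [0, eps[, where H over A b inverts Phi. *)
  move=> p Up UFp; have pe := Uin _ Up; have Fpe : 0 <= multiplier f p.1 * p.2 <= eps.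
    by case: UFp => _ /itv_cc.
  rewrite !mapE /skew_product /=; congr pair.
  by apply: conj => //; case: Up.
split.
  move=> b _.
  have DE x : [set` `[(0:R), eps[] x -> x + (H b x - x) = D 0%N b x.
    by move=> _; rewrite D0 addrC subrK.
  split=> [i x ik xI|i ik].
    exact: (jet_derivable_in acc DE (jetH b) (ltnW ik) xI).
  apply: (@holder_within_continuous _ _ _ K g) => // s t sI tI.
  have iK := leqW ik.
  rewrite !(jet_derive_in_n acc DE (jetH b) iK)//.
  have [_ _ _ uh] := hK i iK.
  by have := uh b b _ _ (itv_cc _ sI) (itv_cc _ tI); rewrite (rho_fiber snr).
(* The first term converts the exponent g from the modulus to the distance; halving in the second
   makes the required inequality strict. *)
pose al := Num.min (Num.min beta 1 * g) (Num.min beta X / 2).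
have m0 : 0 < Num.min beta 1 by rewrite lt_min beta0 ltr01.
have mX0 : 0 < Num.min beta X by rewrite lt_min beta0.
have al0 : 0 < al by rewrite lt_min mulr_gt0//= divr_gt0.
have alm : al <= Num.min beta 1 * g by rewrite ge_min lexx.
have alX : al < Num.min beta X.
  have : al <= Num.min beta X / 2 by rewrite /al ge_min lexx orbT.
  lra.
(* One constant serves all orders l; the summand 1 makes it positive even if K = 0. *)
exists (fun=> K * 2 `^ g + 1), al; split=> //.
  by move=> l _; rewrite ltr_wpDl// mulr_ge0// powR_ge0.
move=> l b b' ln bV b'V.
apply: (@norm_C_le _ _ acc n.+1 (fun i x => D i b x - D i b' x)) => //.
- by move=> x xI; rewrite /= D0; ring.
- exact: jetB.
- exact: leqW.
- by rewrite mulr_ge0 ?powR_ge0// addr_ge0// mulr_ge0 ?powR_ge0.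
move=> i x il xI; have [_ _ _ uh] := hK i (leq_trans il (leqW ln)).
have xe := itv_cc _ xI; apply: (le_trans (uh b b' _ _ xe xe)).
have d1 : torus_dist b b' <= 1.
  apply: (le_trans (torus_dist_triangle b b0 b')); rewrite (torus_dist_sym b0 b').
  by move: bV b'V => /= ? ?; lra.
rewrite /rho subrr normr0 addr0 mulrDl mul1r; apply: ler_wpDr; first exact: powR_ge0.
rewrite -mulrA ler_wpM2l//; apply: modulus_powR_le => //.
by rewrite al0.
Qed.
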